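(* Let $(G,S)$ be a Cayley graph of a group of polynomial growth with homogeneous dimension $N\geq3$. Let $p,q>1$, $p'=\frac p{p-1}$, $q'=\frac q{q-1}$, and suppose $\frac1{p'}+\frac1q<\frac{N-2}N$. Then there is a pair of positive solutions $(u,v)$ of the Lane–Emden system $$-\Delta u=|v|^{p'-2}v,\qquad -\Delta v=|u|^{q-2}u\quad\text{on }G,\qquad u\in D^{2,p}(G),\ v\in D^{2,q'}(G),$$ that is, a solution with $u(x)>0$ and $v(x)>0$ for all $x\in G$.
   Context: $G$ is a finitely generated group and $S$ a finite generating set with $S=S^{-1}$. The Cayley graph $(G,S)$ has vertex set $G$, and $x\sim y$ iff $x=ys$ for some $s\in S$. $\beta_S(n)$ is the number of elements of $G$ at word distance at most $n$ from the unit element. $G$ is of polynomial growth with homogeneous dimension $N\in\mathbb N$ if there are constants $C_1,C_2>0$ depending on $S$ with $C_1n^N\le\beta_S(n)\le C_2n^N$ for all $n\ge1$. For $u:G\to\mathbb R$, $\Delta u(x):=\sum_{y\sim x}(u(y)-u(x))$. For $1<r<\frac N2$, $\lVert u\rVert_{D^{2,r}(G)}:=\lVert\Delta u\rVert_{\ell^r(G)}$ and $D^{2,r}(G):=\{u\in\ell^{\frac{Nr}{N-2r}}(G):\lVert u\rVert_{D^{2,r}(G)}<\infty\}$. (The hypothesis forces $p<\frac N2$ and $q'<\frac N2$, so the spaces are defined.) *)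

(* Defs.v *)
From mathcomp Require Import all_boot all_order all_algebra.
From mathcomp Require Import finmap.
From mathcomp Require Import all_classical all_reals all_analysis.
Set Implicit Arguments.
Unset Strict Implicit.
Unset Printing Implicit Defensive.
Import Order.TTheory GRing.Theory Num.Theory.
Local Open Scope classical_set_scope.
Local Open Scope ring_scope.

Section CayleyGraph.
Variables (G : groupType) (S : set G).

Definition is_word (w : seq G) : Prop := forall s, s \in w -> S s.

Definition generates : Prop :=
  forall x : G, exists2 w, is_word w & x = (\prod_(s <- w) s)%g.

Definition finite_symmetric_generating : Prop :=
  [/\ finite_set S, S = [set (s^-1)%g | s in S] & generates].

Definition adjacent (x y : G) : Prop := exists2 s, S s & x = (y * s)%g.

Definition joined_by_word (x y : G) (n : nat) : Prop :=
  exists w, [/\ is_word w, size w = n & y = (x * \prod_(s <- w) s)%g].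

Definition word_distance (x y : G) (d : nat) : Prop :=
  joined_by_word x y d /\ forall m, joined_by_word x y m -> (d <= m)%N.

Definition word_ball (n : nat) : set G :=
  [set x | exists2 d, word_distance 1%g x d & (d <= n)%N].

(* [fset_set] is the junk value [fset0] on infinite sets; balls are finite
   because [S] is. *)
Definition growth (n : nat) : nat := #|` fset_set (word_ball n)|%fset.

Definition polynomial_growth (R : realType) (N : nat) : Prop :=
  exists C1 C2 : R, [/\ 0 < C1, 0 < C2 & forall n : nat, (1 <= n)%N ->
    C1 * n%:R ^+ N <= (growth n)%:R <= C2 * n%:R ^+ N].

(* The sum ranges over the set of neighbours, without multiplicity; it is a
   genuine finite sum because [S] is finite. *)
Definition laplacian (R : realType) (u : G -> R) (x : G) : R :=
  \sum_(y \in [set y | adjacent y x]) (u y - u x).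

End CayleyGraph.

Section FunctionSpaces.
Variables (R : realType) (G : groupType).

Definition lnorm (r : R) (u : G -> R) : \bar R :=
  ((\esum_(x in [set: G]) (`|u x| `^ r)%:E) `^ r^-1)%E.

Definition in_l (r : R) (u : G -> R) : Prop := (lnorm r u < +oo)%E.

Definition D2norm (S : set G) (r : R) (u : G -> R) : \bar R :=
  lnorm r (laplacian S u).

(* Meaningful only for [1 < r < N / 2]. *)
Definition in_D2 (S : set G) (N : nat) (r : R) (u : G -> R) : Prop :=
  in_l (N%:R * r / (N%:R - 2 * r)) u /\ (D2norm S r u < +oo)%E.

End FunctionSpaces.

Definition conj_exponent (R : realType) (p : R) : R := p / (p - 1).

(* Main.v *)
Require Import Defs.
From mathcomp Require Import all_boot all_order all_algebra finmap.
From mathcomp Require Import all_classical all_reals all_analysis.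
From mathcomp Require Import ring lra zify.
Set Implicit Arguments.
Unset Strict Implicit.
Unset Printing Implicit Defensive.
Import Order.TTheory GRing.Theory Num.Theory.
Import numFieldNormedType.Exports.
Local Open Scope classical_set_scope.
Local Open Scope ring_scope.

(** Let [Q] be the lazy walk that moves from [x] to [x * t] with [t] uniform in
[T = 1 :: S], and let [d = size T], so that [- laplacian = d (1 - Q)].  Writing
[f = - laplacian u] and [g = - laplacian v], the system reads [f = v^(p'-1)],
[g = u^(q-1)], where [u] and [v] are the Green potentials of [f] and [g].  Up to
constants these are the Euler-Lagrange equations of the problem of maximising
the Green energy [<f, (- laplacian)^-1 g>] over nonnegative [f], [g] with
[||f||_p <= 1] and [||g||_b <= 1], where [b = q'].  The assumption on the exponents
is [1/p + 1/b - 1 > 2/N]: the Hardy-Littlewood-Sobolev inequality holds with room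
to spare, and this room is the only source of compactness.

Heat kernel.  Put [c n = p_2n(1,1)].  The function [g |-> c n - p_2n(1,g)] is half
a squared l^2 distance, so at word length [r] it is at most [r^2] times its
supremum over [T], which is at most [d^2 (c n - c n.+1)] because [1] is in [T].
Averaging over a ball, where [p_2n(1,.)] has total mass at most [1], yields the
Nash-type inequality [c n <= 1/beta(r) + r^2 d^2 (c n - c n.+1)]
([return_prob_ball]).  With [beta(r) >= C r^N] it forces [c n] to decay like
[n^(-N/2)] ([nash_decay]).

Energy bound.  A kernel with row and column sums at most [1] and entries at most
[A] satisfies [<f, k g> <= A^(1/a+1/b-1) ||f||_a ||g||_b] ([heat_pair]).  With
[A] of order [n^(-N/2)], the sum over the steps [n] of the walk is bounded when
[N (1/a+1/b-1) > 2] ([energy_bound]).  The potentials are cut off after [m] steps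
of the walk and the functions are finitely supported, so every sum is finite; the
cut-off only disturbs the equation by [Q^m f], which tends to [0].

Maximising sequence ([maximizing_sequence]).  Given [g], replacing [f] by the
dual function of the potential of [g] does not decrease the energy, and the
spare room bounds the new [f] in [l^p0] for some [p0 < p] ([energy_improvement]).
The same room shows that a near-maximiser cannot spread out: it is at least some
[c0 > 0] somewhere ([near_maximizer_nonvanishing]), and by left translation this
happens at [1].

Limit ([profile_exists]).  For [f], [g] of energy close to the supremum [M],
Young's inequality between [f] and the potential of [g] divided by [M] is almost
an equality in total, hence at every point, since all the deficits are nonnegative
([young_deficit]).  Along an ultrafilter all four functions converge pointwise,
and the equality case of Young's inequality is the Euler-Lagrange equation of the
limits.  The bound in [l^p0] puts the limit [u] in the critical space [l^(Np/(N-2p))].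

Finally, a nonnegative superharmonic function that vanishes somewhere vanishes
everywhere, so [u] and [v] are positive, and since [(p'-1)(q-1) <> 1] the
constants can be normalised by scaling [u] and [v] separately ([scaling_pair]). *)

(** * The heat kernel of the lazy walk *)

Lemma sum_cst (R : pzSemiRingType) (I : Type) (r : seq I) (a : R) :
  \sum_(i <- r) a = (size r)%:R * a.
Proof. by rewrite big_const_seq count_predT iter_addr_0 mulr_natl. Qed.

Section SupportedOn.
Variables (R : realType) (G : choiceType).

Definition supported_on (Z : seq G) (h : G -> R) := forall x, x \notin Z -> h x = 0.

Definition dirac_at (y x : G) : R := (x == y)%:R.

Lemma supported_sum Z Z' (h : G -> R) : uniq Z -> uniq Z' ->
  supported_on Z h -> supported_on Z' h ->
  \sum_(x <- Z) h x = \sum_(x <- Z') h x.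
Proof.
move=> uZ uZ' sZ sZ'.
rewrite (bigID (mem Z')) /= [X in _ + X]big1 ?addr0; last first.
  by move=> x xZ'; exact: sZ'.
rewrite [RHS](bigID (mem Z)) /= [X in _ = _ + X]big1 ?addr0; last first.
  by move=> x xZ; exact: sZ.
rewrite -big_filter -[RHS]big_filter; apply: perm_big.
apply: uniq_perm; rewrite ?filter_uniq// => x.
by rewrite !mem_filter andbC.
Qed.

(** Expanding in point masses turns a statement about the walk applied to [h]
    into one about the kernel of the walk. *)
Lemma supported_dirac_sum Z (h : G -> R) : uniq Z -> supported_on Z h ->
  h = (fun x => \sum_(z <- Z) h z * dirac_at z x).
Proof.
move=> uZ sZ; apply/funext => x.
have [xZ|xZ] := boolP (x \in Z).
  rewrite (bigD1_seq x)//= /dirac_at eqxx mulr1 big1 ?addr0// => z zx.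
  by rewrite eq_sym (negbTE zx) mulr0.
rewrite sZ// big_seq big1// => z zZ; rewrite /dirac_at.
have [xz|_] := eqVneq x z; last by rewrite mulr0.
by move: xZ; rewrite xz zZ.
Qed.

End SupportedOn.

Section Walk.
Variables (R : realType) (G : groupType) (T : seq G).
Hypothesis T1 : 1%g \in T.
Hypothesis TV : perm_eq [seq t^-1%g | t <- T] T.

Definition step_count : R := (size T)%:R.
Local Notation d := step_count.

Lemma step_count_ge1 : 1 <= d.
Proof.
by rewrite /step_count ler1n; case: (T) T1.
Qed.

Lemma step_count_gt0 : 0 < d.
Proof. exact: lt_le_trans step_count_ge1. Qed.

Lemma step_count_ge0 : 0 <= d.
Proof. exact: ltW step_count_gt0. Qed.

Lemma step_count_neq0 : d != 0.
Proof. by rewrite gt_eqF// step_count_gt0. Qed.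

Definition avg (f : G -> R) (x : G) : R := d^-1 * \sum_(t <- T) f (x * t)%g.

Definition heat (n : nat) (f : G -> R) : G -> R := iter n avg f.

(** The transition probability [p_n(x,y)]; defining it through the action of
    the walk on the point mass at [y] keeps all sums finite. *)
Definition hk (n : nat) (x y : G) : R := heat n (dirac_at R y) x.

Lemma heatS n f x : heat n.+1 f x = d^-1 * \sum_(t <- T) heat n f (x * t)%g.
Proof. by []. Qed.

Lemma heatD m n f : heat (m + n) f = heat m (heat n f).
Proof. by rewrite /heat iterD. Qed.

Lemma avg_le f g : (forall x, f x <= g x) -> forall x, avg f x <= avg g x.
Proof.
move=> fg x; rewrite ler_wpM2l ?invr_ge0 ?step_count_ge0//.
apply: ler_sum => t _; exact: fg.
Qed.

Lemma heat_le n f g : (forall x, f x <= g x) -> forall x, heat n f x <= heat n g x.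
Proof. by move=> fg; elim: n => //= n IH; exact: avg_le. Qed.

Lemma heat_cst n (c : R) x : heat n (fun=> c) x = c.
Proof.
elim: n x => //= n IH x; rewrite /avg (eq_bigr (fun=> c))// sum_cst -/step_count mulKf//.
exact: step_count_neq0.
Qed.

Lemma heat_ge0 n f : (forall x, 0 <= f x) -> forall x, 0 <= heat n f x.
Proof. by move=> f0 x; rewrite -(heat_cst n 0 x); exact: heat_le. Qed.

Lemma heat_sum n (I : Type) (r : seq I) (c : I -> R) (h : I -> G -> R) x :
  heat n (fun x => \sum_(i <- r) c i * h i x) x = \sum_(i <- r) c i * heat n (h i) x.
Proof.
elim: n x => [//|n IH x]; rewrite heatS.
under eq_bigr do rewrite IH.
rewrite exchange_big /= mulr_sumr; apply: eq_bigr => i _.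
by rewrite -mulr_sumr mulrCA.
Qed.

Lemma heat_translate n f z x : heat n (fun y => f (z * y)%g) x = heat n f (z * x)%g.
Proof.
elim: n x => [//|n IH x]; rewrite !heatS; congr (_ * _).
by apply: eq_bigr => t _; rewrite IH mulgA.
Qed.

Lemma heat_supportedE n Z f x : uniq Z -> supported_on Z f ->
  heat n f x = \sum_(z <- Z) f z * hk n x z.
Proof. by move=> uZ sZ; rewrite {1}(supported_dirac_sum uZ sZ) heat_sum. Qed.

Lemma heatZ n (k : R) f x : heat n (fun y => k * f y) x = k * heat n f x.
Proof.
elim: n x => [//|n IH] x; rewrite !heatS [RHS]mulrCA.
by congr (_ * _); rewrite mulr_sumr; apply: eq_bigr => t _; exact: IH.
Qed.

Lemma hk_ge0 n x y : 0 <= hk n x y.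
Proof. by apply: heat_ge0 => z; rewrite /dirac_at ler0n. Qed.

Lemma hk_translate n z x y : hk n (z * x)%g (z * y)%g = hk n x y.
Proof.
rewrite /hk -heat_translate; congr (heat n _ x); apply/funext => w.
by rewrite /dirac_at (inj_eq (mulgI z)).
Qed.

Lemma hkS n x y : hk n.+1 x y = d^-1 * \sum_(t <- T) hk n (x * t)%g y.
Proof. by []. Qed.

(** The last step of the walk can be split off instead of the first one
    because [T] is closed under inverses. *)
Lemma hkSr n x y : hk n.+1 x y = d^-1 * \sum_(t <- T) hk n x (y * t)%g.
Proof.
elim: n x => [|n IH] x.
  rewrite /hk /= /avg; congr (_ * _).
  rewrite -(perm_big _ TV) big_map; apply: eq_bigr => t _.
  by rewrite /dirac_at -(inj_eq (mulIg t) (x * t^-1)%g y) mulgVK.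
rewrite hkS; congr (_ * _).
rewrite (eq_bigr (fun t => d^-1 * \sum_(t' <- T) hk n (x * t)%g (y * t')%g)); last first.
  by move=> t _; rewrite -IH.
rewrite -mulr_sumr exchange_big /= mulr_sumr; apply: eq_bigr => t _.
by [].
Qed.

Lemma hk_sym n x y : hk n x y = hk n y x.
Proof.
elim: n x y => [|n IH] x y; first by rewrite /hk /= /dirac_at eq_sym.
rewrite hkSr hkS; congr (_ * _).
by apply: eq_bigr => t _; rewrite -IH.
Qed.

Lemma heat_supported n f Z : supported_on Z f ->
  exists2 Z', uniq Z' & supported_on Z' (heat n f).
Proof.
move=> sZ; elim: n => [|n [Z' uZ' sZ']].
  exists (undup Z); first exact: undup_uniq.
  by move=> x; rewrite mem_undup; exact: sZ.
exists (undup [seq (z * t^-1)%g | z <- Z', t <- T]); first exact: undup_uniq.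
move=> x; rewrite mem_undup => xZ; rewrite heatS big_seq big1 ?mulr0// => t tT.
apply: sZ'; apply: contra xZ => xt.
by apply/allpairsP; exists ((x * t)%g, t); split => //=; rewrite mulgK.
Qed.

Lemma hk_supported n (ys : seq G) :
  exists2 Z, uniq Z & forall y, y \in ys -> supported_on Z (hk n ^~ y).
Proof.
elim: ys => [|y ys [Z uZ sZ]]; first by exists [::].
have [Z' uZ' sZ'] : exists2 Z', uniq Z' & supported_on Z' (hk n ^~ y).
  apply: (@heat_supported n (dirac_at R y) [:: y]) => x.
  by rewrite inE /dirac_at => /negbTE ->.
exists (undup (Z ++ Z')); first exact: undup_uniq.
move=> w; rewrite inE => /orP[/eqP->|wys] x; rewrite mem_undup mem_cat negb_or.
  by move=> /andP[_ /sZ'].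
by move=> /andP[+ _]; exact: sZ.
Qed.

Lemma chapman_kolmogorov m n x y Z : uniq Z -> supported_on Z (hk n ^~ y) ->
  hk (m + n) x y = \sum_(z <- Z) hk m x z * hk n z y.
Proof.
move=> uZ sZ; rewrite {1}/hk heatD (heat_supportedE _ _ uZ sZ).
by apply: eq_bigr => z _; rewrite mulrC.
Qed.

Lemma hk_sum_le1 n x F : uniq F -> \sum_(y <- F) hk n x y <= 1.
Proof.
move=> uF.
pose f y : R := (y \in F)%:R.
have sf : supported_on F f by move=> y /negbTE; rewrite /f => ->.
have -> : \sum_(y <- F) hk n x y = heat n f x.
  rewrite (heat_supportedE _ _ uF sf) !big_seq; apply: eq_bigr => y yF.
  by rewrite /f yF mul1r.
rewrite -(heat_cst n 1 x); apply: heat_le => y.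
by rewrite /f; case: (y \in F).
Qed.

(** Only even times are used, since [p_2n(1,1)] is the squared l^2 norm of
    [p_n(1,.)]. *)
Definition return_prob (n : nat) : R := hk (n + n) 1%g 1%g.
Local Notation c := return_prob.

(** By [defectE] this is half the squared l^2 distance between [p_n(x,.)] and
    [p_n(y,.)]: it plays the role of a squared metric on the group. *)
Definition defect (n : nat) (x y : G) : R := c n - hk (n + n) x y.

Lemma hk_diag n x : hk n x x = hk n 1%g 1%g.
Proof. by rewrite -(hk_translate n x 1 1) mulg1. Qed.

Lemma defectE n x y Z : uniq Z -> supported_on Z (hk n ^~ x) ->
  supported_on Z (hk n ^~ y) ->
  defect n x y = 2^-1 * \sum_(z <- Z) (hk n z x - hk n z y) ^+ 2.
Proof.
move=> uZ sx sy.
have E a b : supported_on Z (hk n ^~ b) ->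
    \sum_(z <- Z) hk n z a * hk n z b = hk (n + n) a b.
  move=> sb; rewrite (chapman_kolmogorov _ _ uZ sb).
  by apply: eq_bigr => z _; rewrite (hk_sym n a).
under eq_bigr do rewrite sqrrB -mulr_natr.
rewrite !big_split/= sumrN -mulr_suml.
have E2 a : supported_on Z (hk n ^~ a) ->
    \sum_(z <- Z) hk n z a ^+ 2 = hk (n + n) a a.
  by move=> sa; rewrite -E//; apply: eq_bigr => z _; rewrite expr2.
rewrite !E2// E// /defect /return_prob !(hk_diag _ x) !(hk_diag _ y).
by field.
Qed.

Lemma defect_ge0 n x y : 0 <= defect n x y.
Proof.
have [Z uZ sZ] := hk_supported n [:: x; y].
rewrite (@defectE n x y Z)//; try by apply: sZ; rewrite !inE eqxx ?orbT.
by rewrite mulr_ge0 ?invr_ge0// sumr_ge0// => z _; rewrite sqr_ge0.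
Qed.

(** The triangle inequality for the l^2 distance, squared: [l (a + b)^2 <= (l
    + 1) a^2 + l (l + 1) b^2] because the difference is [(a - l b)^2]. The
    weights are chosen so that induction on the length of a word gives exactly
    the factor [l^2]. *)
Lemma defect_triangle n x y z (l : nat) :
  l%:R * defect n x z <=
    l.+1%:R * defect n x y + (l * l.+1)%:R * defect n y z.
Proof.
have [Z uZ sZ] := hk_supported n [:: x; y; z].
rewrite !(@defectE n _ _ Z)//; try by apply: sZ; rewrite !inE eqxx ?orbT.
rewrite !(mulrCA _ 2^-1) -mulrDr ler_wpM2l ?invr_ge0// !mulr_sumr -big_split/=.
apply: ler_sum => w _.
rewrite natrM -natr1.
move: (hk n w x) (hk n w y) (hk n w z) (l%:R : R) => a b e k.
rewrite -subr_ge0.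
have -> : (k + 1) * (a - b) ^+ 2 + k * (k + 1) * (b - e) ^+ 2 - k * (a - e) ^+ 2 =
  ((a - b) - k * (b - e)) ^+ 2 by ring.
exact: sqr_ge0.
Qed.

Lemma defect_translate n z x y : defect n (z * x)%g (z * y)%g = defect n x y.
Proof. by rewrite /defect hk_translate. Qed.

(** A distance grows at most linearly along a word, so its square grows at
    most quadratically. This is the pseudo-Poincare inequality for the heat
    kernel. *)
Lemma defect_word n (w : seq G) (E : R) :
  (forall s, s \in w -> defect n 1%g s <= E) ->
  defect n 1%g (\prod_(s <- w) s)%g <= (size w)%:R ^+ 2 * E.
Proof.
elim/last_ind: w => [|w s IH] wE.
  by rewrite big_nil /defect subrr expr0n mul0r.
rewrite -cats1 big_cat big_seq1 /= size_cat /= addn1.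
set g := (\prod_(s <- w) s)%g.
have sE : defect n g (g * s)%g <= E.
  rewrite -[X in defect n X](mulg1 g) defect_translate; apply: wE.
  by rewrite mem_rcons mem_head.
have gE : defect n 1%g g <= (size w)%:R ^+ 2 * E.
  by apply: IH => t tw; apply: wE; rewrite mem_rcons in_cons tw orbT.
have [/size0nil w0|wn0] := eqVneq (size w) 0%N.
  move: sE; rewrite /g w0 big_nil /= expr1n !mul1g.
  by rewrite mul1r.
have k0 : 0 < (size w)%:R :> R by rewrite ltr0n lt0n.
rewrite -(ler_pM2l k0); apply: le_trans (defect_triangle _ _ g _ _) _.
rewrite natrM -natr1.
move: (size w)%:R k0 gE => k k0 gE.
apply: (@le_trans _ _ ((k + 1) * (k ^+ 2 * E) + k * (k + 1) * E)).
  by apply: lerD; apply: ler_wpM2l => //; nra.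
by rewrite le_eqVlt; apply/orP; left; apply/eqP; ring.
Qed.

Lemma hk_le_return n x y : hk (n + n) x y <= c n.
Proof. by rewrite -subr_ge0; exact: defect_ge0. Qed.

(** Two more steps of the walk average the kernel over all products [s * t].
    *)
Lemma return_probS n :
  d ^+ 2 * (c n - c n.+1) = \sum_(s <- T) \sum_(t <- T) defect n 1%g (s * t)%g.
Proof.
have -> : c n.+1 = d^-1 * \sum_(s <- T) d^-1 * \sum_(t <- T) hk (n + n) 1%g (s * t)%g.
  rewrite /return_prob addSn addnS hkSr; congr (_ * _); apply: eq_bigr => s _.
  by rewrite mul1g hkSr.
rewrite /defect -mulr_sumr mulrBr expr2 -!mulrA.
rewrite [d * (d^-1 * _)]mulVKf ?step_count_neq0// mulVKf ?step_count_neq0//.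
by under [RHS]eq_bigr do rewrite sumrB sum_cst; rewrite sumrB sum_cst.
Qed.

(** All terms of the sum in [return_probS] are nonnegative and [(s, 1)] is one
    of the pairs, because the walk is lazy. *)
Lemma defect_step n s : s \in T -> defect n 1%g s <= d ^+ 2 * (c n - c n.+1).
Proof.
move=> sT; rewrite return_probS (big_rem s)//= (big_rem 1%g)//= mulg1 -addrA.
rewrite lerDl addr_ge0// sumr_ge0// => *; last first.
  by rewrite sumr_ge0// => *; exact: defect_ge0.
exact: defect_ge0.
Qed.

Lemma return_prob_nincr n : c n.+1 <= c n.
Proof.
rewrite -subr_ge0 -(@pmulr_rge0 _ (d ^+ 2)) ?exprn_gt0 ?step_count_gt0//.
by apply: le_trans (defect_ge0 n 1 1) (defect_step n T1).
Qed.

Lemma return_prob_ge0 n : 0 <= c n.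
Proof. exact: hk_ge0. Qed.

Lemma return_prob0 : c 0 = 1.
Proof. by rewrite /return_prob /hk /= /dirac_at eqxx. Qed.

Lemma hk_le n x y : hk n x y <= c n./2.
Proof.
rewrite -{1}(odd_double_half n) -addnn; case: (odd n); last exact: hk_le_return.
rewrite add1n hkSr mulrC ler_pdivrMr ?step_count_gt0//.
apply: le_trans (_ : \sum_(t <- T) c n./2 <= _).
  by apply: ler_sum => t _; exact: hk_le_return.
by rewrite sum_cst mulrC.
Qed.

(** The Nash-type inequality: on a ball [B] the kernel is at least [c n] minus
    the quadratic bound on the defect, while its total mass on [B] is at most
    [1]. *)
Lemma return_prob_ball n r (B : seq G) : uniq B ->
  (forall g, g \in B -> exists w : seq G,
     [/\ {subset w <= T}, (size w <= r)%N & g = (\prod_(s <- w) s)%g]) ->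
  (size B)%:R * c n <= 1 + (size B)%:R * (r%:R ^+ 2 * (d ^+ 2 * (c n - c n.+1))).
Proof.
move=> uB Bw.
have defB g : g \in B -> defect n 1%g g <= r%:R ^+ 2 * (d ^+ 2 * (c n - c n.+1)).
  move=> /Bw[w [wT wr ->]].
  apply: le_trans (defect_word (E := d ^+ 2 * (c n - c n.+1)) _) _.
    by move=> s /wT; exact: defect_step.
  rewrite ler_wpM2r//.
    by rewrite mulr_ge0 ?sqr_ge0// subr_ge0 return_prob_nincr.
  by rewrite lerXn2r ?nnegrE ?ler_nat// ler0n.
have: \sum_(g <- B) c n <= \sum_(g <- B) (hk (n + n) 1%g g + r%:R ^+ 2 * (d ^+ 2 * (c n - c n.+1))).
  rewrite !big_seq; by apply: ler_sum => g /defB; rewrite lerBlDl.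
rewrite big_split/= !sum_cst => /le_trans; apply.
by rewrite lerD2r hk_sum_le1.
Qed.

End Walk.

(** * From the Nash inequality to heat kernel decay *)

Section Decay.
Variable R : realType.

(** Bernoulli's inequality in the form that turns [m] contractions by [1 -
    eta] into a gain [1 / (1 + m eta)]. *)
Lemma bernoulli_inv (eta : R) m : 0 <= eta <= 1 ->
  (1 - eta) ^+ m * (1 + m%:R * eta) <= 1.
Proof.
move=> /andP[e0 e1]; elim: m => [|m IH]; first by rewrite expr0 mul0r addr0 mulr1.
apply: le_trans IH; rewrite exprS mulrAC mulrC.
rewrite ler_wpM2l ?exprn_ge0 ?subr_ge0// -natr1.
have : 0 <= m%:R :> R by rewrite ler0n.
move: (m%:R : R) => k k0; nra.
Qed.

Lemma contraction_decay (c : nat -> R) (eps eta : R) n m : 0 <= eta <= 1 ->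
  (forall j, eta * (c j - eps) <= c j - c j.+1) ->
  c (n + m)%N - eps <= (1 - eta) ^+ m * (c n - eps).
Proof.
move=> /andP[e0 e1] cS; elim: m => [|m IH]; first by rewrite addn0 expr0 mul1r.
rewrite addnS exprS -mulrA.
apply: le_trans (_ : (1 - eta) * (c (n + m)%N - eps) <= _); last first.
  by rewrite ler_wpM2l// subr_ge0.
have := cS (n + m)%N; nra.
Qed.

(** With [r = 2 ^ k] the hypothesis says that [c - K / r ^ N] contracts by the
    factor [1 - 1 / (E 4 ^ k)] at each step. Running it for [L * 4 ^ k] steps,
    with [L] large compared with [E 2 ^ N], divides the bound by [2 ^ N] while
    the time grows by the factor [4]: this is the decay [n ^ (- N / 2)] along
    [n = L * 4 ^ k]. *)
Lemma nash_decay (c : nat -> R) (N : nat) (K E : R) :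
  (forall n, c n.+1 <= c n) -> c 0%N <= 1 -> 0 <= K -> 1 <= E ->
  (forall n r, (1 <= r)%N ->
    c n <= K / r%:R ^+ N + r%:R ^+ 2 * (E * (c n - c n.+1))) ->
  exists L H, [/\ (1 <= L)%N, 0 <= H &
    forall k, c (L * 4 ^ k)%N <= H * (2^-1 ^+ N) ^+ k].
Proof.
move=> cS c0 K0 E1 cN.
have E0 : 0 < E by lra.
have cmono : {homo c : m n / (m <= n)%N >-> n <= m}.
  by apply/nonincreasing_seqP.
pose D : R := 2 ^+ N.+1.
have D1 : 1 <= D by rewrite /D; apply: exprn_ege1; lra.
(* [L / E >= 2 ^ (N + 1)] leaves half of the target for [K / r ^ N] *)
pose L := (Num.truncn (E * D)).+1.
have LE : E * D <= L%:R by rewrite ltW// truncnS_gt.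
pose H := Num.max 1 (K * D).
have H1 : 1 <= H by rewrite le_max lexx.
have HK : K * D <= H by rewrite le_max lexx orbT.
exists L, H; split => //; first lra.
elim=> [|k IH].
  rewrite expn0 muln1 expr0 mulr1; apply: le_trans H1; apply: le_trans c0.
  exact: cmono.
set th := (2^-1 ^+ N) in IH *.
have th0 : 0 <= th ^+ k by rewrite !exprn_ge0// invr_ge0.
pose eta := (E * 4 ^+ k)^-1.
have E4 : 1 <= E * 4 ^+ k by rewrite mulr_ege1// exprn_ege1//; lra.
have eta01 : 0 <= eta <= 1.
  by rewrite invr_ge0 (le_trans _ E4)//= invf_le1// (lt_le_trans _ E4).
have pow2 : (2 ^ k)%:R ^+ 2 = 4 ^+ k :> R.
  by rewrite natrX -exprM mulnC exprM -natrX.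
have pow2N : K / (2 ^ k)%:R ^+ N = K * th ^+ k.
  by rewrite natrX /th -!exprM mulnC exprVn.
have step j : eta * (c j - K * th ^+ k) <= c j - c j.+1.
  have := cN j (2 ^ k)%N; rewrite pow2N pow2 expn_gt0 => /(_ isT) h.
  rewrite mulrC ler_pdivrMr; last by lra.
  move: h; rewrite mulrA (mulrC (4 ^+ k)); lra.
have := @contraction_decay c (K * th ^+ k) eta (L * 4 ^ k) (L * 4 ^ k) eta01 step.
have := @bernoulli_inv eta (L * 4 ^ k) eta01.
have etaL : D <= (L * 4 ^ k)%:R * eta.
  rewrite ler_pdivlMr; last by lra.
  rewrite natrM natrX; have : 0 <= 4 ^+ k :> R by rewrite exprn_ge0.
  move: (4 ^+ k : R) LE => q; nra.
set q := (1 - eta) ^+ _ => qle cle.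
have q0 : 0 <= q by rewrite exprn_ge0// subr_ge0; case/andP: eta01.
have qD : q * D <= 1 by nra.
have cc : c (L * 4 ^ k.+1)%N <= c (L * 4 ^ k + L * 4 ^ k)%N.
  by apply: cmono; rewrite expnS mulnCA addnn -mul2n leq_mul2r orbT.
apply: (le_trans cc).
have thD : th * D = 2.
  by rewrite /th /D exprVn exprS mulrCA mulVf ?mulr1// expf_neq0// pnatr_eq0.
have thk : th ^+ k.+1 * D = 2 * th ^+ k by rewrite exprSr -mulrA thD mulrC.
rewrite -(@ler_pM2r _ D); last by lra.
rewrite -mulrA thk.
have X0 : q * (c (L * 4 ^ k)%N - K * th ^+ k) <= q * (H * th ^+ k).
  apply: ler_wpM2l => //; have := mulr_ge0 K0 th0; lra.
have H0 : 0 <= H * th ^+ k by rewrite mulr_ge0//; lra.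
have X1 : q * (H * th ^+ k) * D <= H * th ^+ k.
  by rewrite mulrAC ler_piMl.
have X2 : K * th ^+ k * D <= H * th ^+ k by rewrite mulrAC ler_wpM2r.
move: (q * _) X0 X1 cle => y; nra.
Qed.

(** On the block [L 4^k <= j < L 4^(k+1)] there are [3 L 4^k] terms of size at
    most [H rho^k], so the blocks are dominated by a geometric series of ratio
    [4 rho]. *)
Lemma dyadic_summable (a : nat -> R) (L : nat) (H rho : R) :
  (forall n, 0 <= a n) -> (forall n, a n.+1 <= a n) -> (1 <= L)%N -> 0 <= H ->
  0 <= rho -> 4 * rho < 1 -> (forall k, a (L * 4 ^ k)%N <= H * rho ^+ k) ->
  exists2 C, 0 <= C & forall m, \sum_(j < m) a j <= C.
Proof.
move=> a0 aS L1 H0 r0 r1 aH.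
have amono : {homo a : m n / (m <= n)%N >-> n <= m}.
  by apply/nonincreasing_seqP.
pose C := L%:R * a 0%N + 3 * L%:R * H / (1 - 4 * rho).
have den : 0 < 1 - 4 * rho by lra.
have LR : 0 <= L%:R :> R by rewrite ler0n.
have C0 : 0 <= C.
  by rewrite /C addr_ge0// ?divr_ge0// ?mulr_ge0//; exact: ltW den.
have block k : \sum_(0 <= j < L * 4 ^ k) a j <=
    L%:R * a 0%N + 3 * L%:R * H * (1 - (4 * rho) ^+ k) / (1 - 4 * rho).
  elim: k => [|k IH].
    rewrite expn0 muln1 expr0 subrr mulr0 mul0r addr0.
    apply: le_trans (_ : \sum_(0 <= j < L) a 0%N <= _).
      by apply: ler_sum => j _; exact: amono.
    by rewrite big_const_nat subn0 iter_addr_0 mulr_natl.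
  rewrite (@big_cat_nat _ _ _ (L * 4 ^ k))//=; last by rewrite expnS; lia.
  have B : \sum_(L * 4 ^ k <= j < L * 4 ^ k.+1) a j <= 3 * L%:R * H * (4 * rho) ^+ k.
    apply: le_trans (_ : \sum_(L * 4 ^ k <= j < L * 4 ^ k.+1) (H * rho ^+ k) <= _).
      rewrite !big_nat; apply: ler_sum => j /andP[jL _].
      by apply: le_trans (aH k); exact: amono.
    rewrite big_const_nat iter_addr_0 -(mulr_natl (H * _)).
    have -> : (L * 4 ^ k.+1 - L * 4 ^ k = 3 * L * 4 ^ k)%N by rewrite expnS; lia.
    by rewrite !natrM natrX exprMn le_eqVlt; apply/orP; left; apply/eqP; ring.
  apply: le_trans (lerD IH B) _.
  rewrite -addrA lerD2l -subr_ge0.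
  set y := _ ^+ k; set y' := _ ^+ k.+1.
  have -> : y' = 4 * rho * y by rewrite /y' exprS.
  rewrite le_eqVlt; apply/orP; left; apply/eqP.
  by field; lra.
exists C => // m.
apply: le_trans (_ : \sum_(0 <= j < L * 4 ^ m) a j <= _).
  have mL : (m <= L * 4 ^ m)%N.
    by have := ltn_expl m (isT : (1 < 4)%N); nia.
  rewrite (@big_cat_nat _ _ _ m)//= big_mkord lerDl sumr_ge0//.
apply: le_trans (block m) _.
rewrite lerD2l ler_wpM2r ?invr_ge0 ?(ltW den)// ler_piMr ?mulr_ge0//.
by rewrite lerBlDr lerDl exprn_ge0// mulr_ge0.
Qed.

End Decay.

(** * Conjugate exponents and finite power sums *)

Section YoungPointwise.
Variable R : realType.

(** The tangent line bound [1 + y <= exp y] in multiplicative form;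
    multiplying such bounds gives the weighted arithmetic-geometric inequality
    at once. *)
Lemma powR_le_expR (x e : R) : 0 <= x -> 0 <= e -> x `^ e <= expR (e * (x - 1)).
Proof.
rewrite le_eqVlt => /predU1P[<- e0|x0 e0].
  have [->|en0] := eqVneq e 0; first by rewrite powRr0 mul0r expR0.
  by rewrite powR0// expR_ge0.
rewrite /powR gt_eqF// ler_expR ler_wpM2l//.
by rewrite -{1}[x](subrKC 1); apply: le_ln1Dx; rewrite ltrBrDl subrr.
Qed.

Lemma amgm3 (x y z e1 e2 e3 : R) : 0 <= x -> 0 <= y -> 0 <= z ->
  0 <= e1 -> 0 <= e2 -> 0 <= e3 -> e1 + e2 + e3 = 1 ->
  x `^ e1 * y `^ e2 * z `^ e3 <= e1 * x + e2 * y + e3 * z.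
Proof.
move=> x0 y0 z0 a0 b0 c0 abc.
set m := _ + _ + e3 * z.
have m0 : 0 <= m by rewrite !addr_ge0// mulr_ge0.
apply/ler_addgt0Pr => eps eps0; set m' := m + eps.
have m'0 : 0 < m' by rewrite /m'; lra.
have E t e : 0 <= t -> 0 <= e -> t `^ e <= m' `^ e * expR (e * (t / m' - 1)).
  move=> t0 e0; have {1}-> : t = m' * (t / m') by rewrite mulrCA mulfV ?mulr1// gt_eqF.
  rewrite powRM ?divr_ge0 ?(ltW m'0)// ler_wpM2l ?powR_ge0//.
  by rewrite powR_le_expR// divr_ge0// ltW.
apply: le_trans (_ : (m' `^ e1 * expR (e1 * (x / m' - 1))) *
  (m' `^ e2 * expR (e2 * (y / m' - 1))) * (m' `^ e3 * expR (e3 * (z / m' - 1))) <= _).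
  by rewrite !ler_pM ?mulr_ge0 ?powR_ge0 ?E.
rewrite [X in X <= _](_ : _ = m' `^ (e1 + e2 + e3) * expR (m / m' - 1)); last first.
  have -> : m / m' - 1 = e1 * (x / m' - 1) + e2 * (y / m' - 1) + e3 * (z / m' - 1).
    by rewrite /m -[X in _ - X]abc; field; rewrite gt_eqF.
  rewrite !expRD !powRD ?(gt_eqF m'0) ?implybT//; ring.
rewrite abc powRr1 ?(ltW m'0)// ger_pMr// expR_le1 subr_le0.
by rewrite ler_pdivrMr ?mul1r ?lerDl ?(ltW eps0).
Qed.

(** The integrand of Young's convolution inequality: writing [gam = 1/a + 1/b
    - 1], the product [f k g] is [k^gam] times the weighted geometric mean of
    [f^a k], [k g^b] and [f^a g^b], with weights [1 - 1/b], [1 - 1/a] and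
    [gam], which add up to [1]. *)
Lemma young_kernel (f g k A a b : R) : 0 <= f -> 0 <= g -> 0 <= k -> k <= A ->
  1 <= a -> 1 <= b -> 0 <= a^-1 + b^-1 - 1 ->
  f * k * g <= A `^ (a^-1 + b^-1 - 1) *
    ((1 - b^-1) * (f `^ a * k) + (1 - a^-1) * (k * g `^ b) +
     (a^-1 + b^-1 - 1) * (f `^ a * g `^ b)).
Proof.
move=> f0 g0 k0 kA a1 b1 gam0; set gam := a^-1 + b^-1 - 1 in gam0 *.
have a0 : 0 < a by lra.
have b0 : 0 < b by lra.
have A0 : 0 <= A by exact: le_trans kA.
have al0 : 0 <= 1 - b^-1 by rewrite subr_ge0 invf_le1.
have be0 : 0 <= 1 - a^-1 by rewrite subr_ge0 invf_le1.
set rhs := (X in _ <= X).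
have rhs0 : 0 <= rhs by rewrite mulr_ge0 ?powR_ge0// !addr_ge0 ?mulr_ge0 ?powR_ge0.
have [f00|fn0] := eqVneq f 0; first by rewrite f00 !mul0r.
have [g00|gn0] := eqVneq g 0; first by rewrite g00 mulr0.
have [k00|kn0] := eqVneq k 0; first by rewrite k00 mulr0 mul0r.
have -> : f * k * g = k `^ gam *
    ((f `^ a * k) `^ (1 - b^-1) * (k * g `^ b) `^ (1 - a^-1) * (f `^ a * g `^ b) `^ gam).
  rewrite !powRM ?powR_ge0// -!powRrM.
  have fE : f = f `^ (a * (1 - b^-1)) * f `^ (a * gam).
    rewrite -powRD ?fn0 ?implybT// (_ : a * (1 - b^-1) + a * gam = 1) ?powRr1//.
    by rewrite /gam; field; lra.
  have gE : g = g `^ (b * (1 - a^-1)) * g `^ (b * gam).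
    rewrite -powRD ?gn0 ?implybT// (_ : b * (1 - a^-1) + b * gam = 1) ?powRr1//.
    by rewrite /gam; field; lra.
  have kE : k = k `^ (1 - b^-1) * k `^ (1 - a^-1) * k `^ gam.
    rewrite -!powRD ?kn0 ?implybT// (_ : 1 - b^-1 + (1 - a^-1) + gam = 1) ?powRr1//.
    by rewrite /gam; field; lra.
  rewrite {1}fE {1}gE {1}kE; ring.
apply: ler_pM; rewrite ?mulr_ge0 ?powR_ge0//.
  by rewrite ge0_ler_powR.
by apply: amgm3; rewrite ?mulr_ge0 ?powR_ge0//; rewrite /gam; lra.
Qed.

End YoungPointwise.

Section ConjugateExponent.
Variable R : realType.
Implicit Types a : R.

Lemma conj_exponent_gt1 a : 1 < a -> 1 < conj_exponent a.
Proof.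
by move=> a1; rewrite /conj_exponent ltr_pdivlMr; lra.
Qed.

Lemma conj_exponentV a : 1 < a -> (conj_exponent a)^-1 = 1 - a^-1.
Proof. by move=> a1; rewrite /conj_exponent; field; lra. Qed.

Lemma conj_exponentD a : 1 < a -> a^-1 + (conj_exponent a)^-1 = 1.
Proof. by move=> a1; rewrite conj_exponentV// subrKC. Qed.

Lemma conj_exponentB1 a : 1 < a -> conj_exponent a - 1 = (a - 1)^-1.
Proof. by move=> a1; rewrite /conj_exponent; field; lra. Qed.

Lemma conj_exponentK a : 1 < a -> conj_exponent (conj_exponent a) = a.
Proof. by move=> a1; rewrite /conj_exponent; field; lra. Qed.

Lemma conj_exponentB1M a : 1 < a -> (conj_exponent a - 1) * a = conj_exponent a.
Proof. by move=> a1; rewrite /conj_exponent; field; lra. Qed.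

End ConjugateExponent.

Section PowerSums.
Variables (R : realType) (G : choiceType).
Implicit Types (F : seq G) (f v : G -> R).

Definition psum (a : R) F f : R := \sum_(x <- F) f x `^ a.

Lemma psum_ge0 a F f : 0 <= psum a F f.
Proof. by apply: sumr_ge0 => x _; rewrite powR_ge0. Qed.

Lemma psum_term a F f x : x \in F -> f x `^ a <= psum a F f.
Proof.
move=> xF; rewrite /psum (big_rem x)//= lerDl.
by apply: sumr_ge0 => y _; rewrite powR_ge0.
Qed.

Lemma psum_eq0 a F f x : 0 < a -> psum a F f = 0 -> x \in F -> f x = 0.
Proof.
move=> a0 s0 xF; have := psum_term a f xF; rewrite s0 => h.
by apply: (@powR_eq0_eq0 _ _ a); apply/eqP; rewrite eq_le h powR_ge0.
Qed.

Lemma psumZ a F f (k : R) : 0 <= k -> (forall x, 0 <= f x) ->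
  psum a F (fun x => k * f x) = k `^ a * psum a F f.
Proof.
by move=> k0 f0; rewrite /psum mulr_sumr; apply: eq_bigr => x _; rewrite powRM.
Qed.

(** The extremal function in Hoelder's inequality against [v]: proportional to
    [v^(a'-1)] on [F] and normalised in [l^a]. *)
Definition dual_fun (a : R) F v (x : G) : R :=
  if x \in F then (psum (conj_exponent a) F v `^ a^-1)^-1 * v x `^ (conj_exponent a - 1)
  else 0.

Lemma dual_fun_ge0 a F v x : 0 <= dual_fun a F v x.
Proof. by rewrite /dual_fun; case: ifP => // _; rewrite mulr_ge0 ?invr_ge0 ?powR_ge0. Qed.

Lemma dual_fun_out a F v x : x \notin F -> dual_fun a F v x = 0.
Proof. by rewrite /dual_fun => /negbTE ->. Qed.

Lemma dual_fun_norm a F v : 1 < a -> psum (conj_exponent a) F v != 0 ->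
  psum a F (dual_fun a F v) = 1.
Proof.
move=> a1 s0; set A := psum _ F v in s0 *.
have A0 : 0 < A by rewrite lt_neqAle eq_sym s0 psum_ge0.
rewrite /psum big_seq (eq_bigr (fun x => A^-1 * v x `^ conj_exponent a)).
  by rewrite -big_seq -mulr_sumr mulVf.
move=> x xF; rewrite /dual_fun xF powRM ?invr_ge0 ?powR_ge0//.
rewrite -powRrM conj_exponentB1M// -/A -powRN -powRrM mulNr mulVf; last by lra.
by rewrite powR_inv1// ltW.
Qed.

Lemma dual_fun_pair a F v : 1 < a -> (forall x, 0 <= v x) ->
  psum (conj_exponent a) F v != 0 ->
  \sum_(x <- F) dual_fun a F v x * v x =
    psum (conj_exponent a) F v `^ (conj_exponent a)^-1.
Proof.
move=> a1 v0 s0; set A := psum _ F v in s0 *.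
have A0 : 0 < A by rewrite lt_neqAle eq_sym s0 psum_ge0.
rewrite big_seq (eq_bigr (fun x => (A `^ a^-1)^-1 * v x `^ conj_exponent a)).
  rewrite -big_seq -mulr_sumr -/(psum _ F v) -/A conj_exponentV//.
  by rewrite powRB ?(gt_eqF A0) ?implybT// powRr1 ?(ltW A0)// mulrC.
move=> x xF; rewrite /dual_fun xF -mulrA [X in _ * X]mulrC mulr_powRB1//.
by have := conj_exponent_gt1 a1; lra.
Qed.

(** The converse of Hoelder's inequality, tested on the extremal function. *)
Lemma psum_dual (a C : R) F v : 1 < a -> 0 <= C -> (forall x, 0 <= v x) ->
  (forall f, (forall x, 0 <= f x) -> (forall x, x \notin F -> f x = 0) ->
     psum a F f <= 1 -> \sum_(x <- F) f x * v x <= C) ->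
  psum (conj_exponent a) F v <= C `^ conj_exponent a.
Proof.
move=> a1 C0 v0 H; have [->|s0] := eqVneq (psum (conj_exponent a) F v) 0.
  exact: powR_ge0.
have := H _ (dual_fun_ge0 a F v) (@dual_fun_out a F v).
rewrite dual_fun_norm// dual_fun_pair// => /(_ (lexx _)) h.
have a'0 : 0 < conj_exponent a by have := conj_exponent_gt1 a1; lra.
have := ge0_ler_powR (ltW a'0) (powR_ge0 _ _) C0 h.
by rewrite -powRrM mulVf ?gt_eqF// powRr1// psum_ge0.
Qed.

Lemma psum_hoelder (a : R) F f v : 1 < a -> (forall x, 0 <= f x) ->
  (forall x, 0 <= v x) -> psum a F f <= 1 ->
  \sum_(x <- F) f x * v x <= psum (conj_exponent a) F v `^ (conj_exponent a)^-1.
Proof.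
move=> a1 f0 v0 f1; set a' := conj_exponent a.
have a'1 : 1 < a' := conj_exponent_gt1 a1.
have [A00|s0] := eqVneq (psum a' F v) 0.
  rewrite A00 big_seq big1 ?powR_ge0// => x xF.
  by rewrite (psum_eq0 _ A00 xF) ?mulr0//; lra.
set A := psum a' F v in s0 *.
have A0 : 0 < A by rewrite lt_neqAle eq_sym s0 psum_ge0.
have r0 : 0 < A `^ a'^-1 by rewrite powR_gt0.
rewrite -[X in _ <= X]mul1r -ler_pdivrMr// mulr_suml.
apply: le_trans (_ : \sum_(x <- F) (a^-1 * f x `^ a + a'^-1 * (A^-1 * v x `^ a')) <= _).
  apply: ler_sum => x _; rewrite -mulrA.
  apply: le_trans (conjugate_powR (f0 x) _ _ _ (conj_exponentD a1)) _; try lra.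
    by rewrite divr_ge0 ?(ltW r0).
    by rewrite -/a'; lra.
  rewrite powRM ?invr_ge0 ?(ltW r0)// -powRN -powRrM mulNr mulVf; last by lra.
  rewrite powR_inv1 ?(ltW A0)// (mulrC _ a^-1) (mulrC _ (_^-1)) (mulrC _ A^-1).
  by [].
rewrite big_split/= -!mulr_sumr -!/(psum _ F _) -/A mulVf// mulr1.
rewrite -(conj_exponentD a1) lerD2r ler_piMr// invr_ge0; lra.
Qed.

Lemma psum_pointwise (a K : R) F (h : G -> R) x : 0 < a -> (forall x, 0 <= h x) -> x \in F ->
  psum a F h <= K -> h x <= K `^ a^-1.
Proof.
move=> a0 h0 xE hK; have h1 := le_trans (psum_term a h xE) hK.
rewrite -[h x]powRr1// -(@mulfV _ a) ?gt_eqF// powRrM.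
apply: ge0_ler_powR; rewrite ?nnegrE ?powR_ge0//; first by rewrite invr_ge0 ltW.
exact: le_trans (powR_ge0 _ _) h1.
Qed.

Lemma psum_supported (a : R) E F (f : G -> R) : a != 0 -> uniq E -> uniq F ->
  supported_on F f -> psum a E f <= psum a F f.
Proof.
move=> a0 uE uF sf.
have -> : psum a F f = psum a (undup (F ++ E)) f.
  apply: supported_sum; rewrite ?undup_uniq// => x.
    by move=> /sf ->; rewrite powR0.
  by rewrite mem_undup mem_cat negb_or => /andP[/sf -> _]; rewrite powR0.
rewrite /psum [X in _ <= X](perm_big (E ++ [seq x <- undup (F ++ E) | x \notin E]))/=.
  by rewrite big_cat lerDl sumr_ge0// => x _; exact: powR_ge0.
apply: uniq_perm; rewrite ?undup_uniq// ?cat_uniq.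
  rewrite uE filter_uniq ?undup_uniq// andbT/=; apply/hasPn => x.
  by rewrite mem_filter => /andP[].
move=> x; rewrite mem_cat mem_filter mem_undup mem_cat.
by case: (x \in E); rewrite ?orbT ?orbF ?andbT.
Qed.

End PowerSums.

(** * Truncated Green potentials and the Hardy-Littlewood-Sobolev inequality *)

Section Potential.
Variables (R : realType) (G : groupType) (T : seq G).
Hypothesis T1 : 1%g \in T.
Hypothesis TV : perm_eq [seq t^-1%g | t <- T] T.

Local Notation heat := (@heat R G T).
Local Notation hk := (@hk R G T).
Local Notation c := (return_prob R T).
Local Notation d := (step_count R T).

(** Summing [young_kernel], each of the three terms contributes at most its
    weight: the kernel has row and column sums at most [1], and the weights
    add up to [1]. *)
Lemma heat_pair n F F' (f g : G -> R) a b : 1 <= a -> 1 <= b ->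
  0 <= a^-1 + b^-1 - 1 -> uniq F -> uniq F' -> (forall x, 0 <= f x) ->
  (forall x, 0 <= g x) -> supported_on F' g -> psum a F f <= 1 ->
  psum b F' g <= 1 ->
  \sum_(x <- F) f x * heat n g x <= c n./2 `^ (a^-1 + b^-1 - 1).
Proof.
move=> a1 b1 gam0 uF uF' f0 g0 sg fa gb; set gam := _ - 1 in gam0 *.
set A := c n./2.
have sumle (h : G -> R) (k : G -> R) Z : (forall x, 0 <= h x) -> (forall x, k x <= 1) ->
    \sum_(x <- Z) h x * k x <= \sum_(x <- Z) h x.
  by move=> h0 k1; apply: ler_sum => x _; rewrite ler_piMr.
have al0 : 0 <= 1 - b^-1 by rewrite subr_ge0 invf_le1//; lra.
have be0 : 0 <= 1 - a^-1 by rewrite subr_ge0 invf_le1//; lra.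
apply: le_trans (_ : \sum_(x <- F) \sum_(y <- F') A `^ gam *
   ((1 - b^-1) * (f x `^ a * hk n x y) + (1 - a^-1) * (hk n x y * g y `^ b) +
     gam * (f x `^ a * g y `^ b)) <= _).
  apply: ler_sum => x _; rewrite (heat_supportedE _ _ _ uF' sg) mulr_sumr.
  apply: ler_sum => y _; rewrite (mulrC (g y)) mulrA.
  apply: young_kernel => //; first exact: hk_ge0.
  exact: hk_le.
under eq_bigr do rewrite -mulr_sumr !big_split/= -!mulr_sumr.
rewrite -mulr_sumr ler_piMr ?powR_ge0// !big_split/= -!mulr_sumr.
have S1 : \sum_(x <- F) f x `^ a * \sum_(y <- F') hk n x y <= 1.
  apply: le_trans fa; apply: sumle => x; first exact: powR_ge0.
  exact: hk_sum_le1.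
have S2 : \sum_(x <- F) \sum_(y <- F') hk n x y * g y `^ b <= 1.
  rewrite exchange_big/=; apply: le_trans gb.
  apply: le_trans (_ : \sum_(y <- F') g y `^ b * \sum_(x <- F) hk n y x <= _).
    apply: ler_sum => y _; rewrite -mulr_suml mulrC.
    by under eq_bigr do rewrite hk_sym//.
  apply: sumle => x; first exact: powR_ge0.
  exact: hk_sum_le1.
have S3 : \sum_(x <- F) f x `^ a * \sum_(y <- F') g y `^ b <= 1.
  apply: le_trans fa; apply: sumle => x; first exact: powR_ge0.
  exact: gb.
have := lerD (lerD (ler_piMr al0 S1) (ler_piMr be0 S2)) (ler_piMr gam0 S3).
by move=> /le_trans; apply; rewrite /gam; lra.
Qed.

(** The Green operator [(- laplacian)^-1 = d^-1 (1 + Q + Q^2 + ...)] cut off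
    after [m] steps of the walk. *)
Definition potential (m : nat) (g : G -> R) (x : G) : R :=
  d^-1 * \sum_(j < m) heat j g x.

Lemma potential_ge0 m g : (forall x, 0 <= g x) -> forall x, 0 <= potential m g x.
Proof.
move=> g0 x; rewrite mulr_ge0 ?invr_ge0 ?step_count_ge0// sumr_ge0// => j _.
exact: heat_ge0.
Qed.

Lemma potential_le m m' g : (m <= m')%N -> (forall x, 0 <= g x) ->
  forall x, potential m g x <= potential m' g x.
Proof.
move=> mm g0 x; rewrite ler_wpM2l ?invr_ge0 ?step_count_ge0//.
rewrite -!(big_mkord xpredT (fun j => heat j g x)) (@big_cat_nat _ _ _ m _ _ _ _ _ mm)//= lerDl.
by apply: sumr_ge0 => j _; exact: heat_ge0.
Qed.

Lemma potentialZ m (k : R) f x :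
  potential m (fun y => k * f y) x = k * potential m f x.
Proof.
rewrite /potential [RHS]mulrCA; congr (_ * _).
by rewrite mulr_sumr; apply: eq_bigr => j _; exact: heatZ.
Qed.

Lemma potential_translate m g z x :
  potential m (fun y => g (z * y)%g) x = potential m g (z * x)%g.
Proof. by congr (_ * _); apply: eq_bigr => j _; rewrite heat_translate. Qed.

(** The geometric series telescopes; what remains is the error [Q^m g] of the
    cut-off. *)
Lemma potential_laplacian m g x :
  \sum_(t <- T) (potential m g x - potential m g (x * t)%g) = g x - heat m g x.
Proof.
rewrite sumrB sum_cst -/d /potential mulVKf ?step_count_neq0//.
rewrite -mulr_sumr exchange_big/= mulr_sumr -sumrB.
rewrite (eq_bigr (fun j : 'I_m => heat j g x - heat j.+1 g x)); last by [].
rewrite -(big_mkord xpredT (fun j => heat j g x - heat j.+1 g x)).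
rewrite (eq_bigr (fun j => - (heat j.+1 g x - heat j g x))).
  by rewrite sumrN telescope_sumr// opprB.
by move=> j _; rewrite opprB.
Qed.

Lemma heat_pair_sym n F (f g : G -> R) : uniq F -> supported_on F f ->
  supported_on F g ->
  \sum_(x <- F) f x * heat n g x = \sum_(x <- F) g x * heat n f x.
Proof.
move=> uF sf sg.
under eq_bigr do rewrite (heat_supportedE _ _ _ uF sg) mulr_sumr.
under [RHS]eq_bigr do rewrite (heat_supportedE _ _ _ uF sf) mulr_sumr.
rewrite exchange_big/=; apply: eq_bigr => x _; apply: eq_bigr => y _.
by rewrite mulrCA (hk_sym _ TV).
Qed.

Definition energy m F (f g : G -> R) : R := \sum_(x <- F) f x * potential m g x.

Lemma energyE m F f g :
  energy m F f g = d^-1 * \sum_(j < m) \sum_(x <- F) f x * heat j g x.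
Proof.
rewrite /energy exchange_big/= mulr_sumr; apply: eq_bigr => x _.
by rewrite -mulr_sumr mulrCA.
Qed.

Lemma energy_sym m F f g : uniq F -> supported_on F f -> supported_on F g ->
  energy m F f g = energy m F g f.
Proof.
move=> uF sf sg; rewrite !energyE; congr (_ * _); apply: eq_bigr => j _.
exact: heat_pair_sym.
Qed.

(** The decay [p_2n(1,1) <= C n^(- N / 2)], recorded along the times [L * 4 ^
    k], which is all that dyadic summation needs. *)
Definition heat_dimension (N : nat) := exists L H, [/\ (1 <= L)%N, 0 <= H &
  forall k, c (L * 4 ^ k)%N <= H * (2^-1 ^+ N) ^+ k].

(** The ratio of the dyadic geometric series is below [1] in the supercritical
    range. *)
Lemma half_pow_lt (N : nat) (gam : R) : 2 < N%:R * gam ->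
  4 * (2^-1 ^+ N : R) `^ gam < 1.
Proof.
move=> h.
have -> : (2^-1 ^+ N : R) `^ gam = expR (- (N%:R * gam * ln 2)).
  rewrite -powR_mulrn ?invr_ge0// -powRrM /powR gt_eqF ?invr_gt0//.
  by rewrite lnV ?posrE// mulrN.
have -> : 4 = expR (2 * ln 2) :> R.
  by rewrite expRM_natl lnK ?posrE// -natrX.
rewrite -expRD expR_lt1 -mulNr -mulrDl pmulr_llt0; first by lra.
by rewrite ln_gt0// ltr1n.
Qed.

(** The Hardy-Littlewood-Sobolev inequality off the critical line, uniformly
    in the cut-off: each step of the walk contributes a power of the return
    probability, and these powers are summable. *)
Lemma energy_bound (N : nat) (a b : R) : heat_dimension N -> 1 <= a -> 1 <= b ->
  2 < N%:R * (a^-1 + b^-1 - 1) ->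
  exists2 C, 0 < C & forall m F F' f g, uniq F -> uniq F' ->
    (forall x, 0 <= f x) -> (forall x, 0 <= g x) -> supported_on F' g ->
    psum a F f <= 1 -> psum b F' g <= 1 -> energy m F f g <= C.
Proof.
move=> [L [H [L1 H0 cH]]] a1 b1; set gam := _ - 1 => h.
have gam0 : 0 < gam.
  rewrite ltNge; apply/negP => g0; have : N%:R * gam <= 0 by rewrite mulr_ge0_le0.
  by move: h; lra.
have th0 : 0 <= (2^-1 ^+ N : R) by rewrite exprn_ge0// invr_ge0.
have [C C0 hC] : exists2 C, 0 <= C & forall m, \sum_(j < m) c j./2 `^ gam <= C.
  apply: (@dyadic_summable _ (fun j => c j./2 `^ gam) (2 * L) (H `^ gam) ((2^-1 ^+ N) `^ gam)).
  - by move=> n; exact: powR_ge0.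
  - move=> n; apply: ge0_ler_powR; rewrite ?nnegrE ?return_prob_ge0 ?(ltW gam0)//.
    have /nonincreasing_seqP cmono := @return_prob_nincr R G T T1 TV.
    by apply: cmono; apply: half_leq; exact: leqnSn.
  - by rewrite muln_gt0.
  - exact: powR_ge0.
  - exact: powR_ge0.
  - exact: half_pow_lt.
  - move=> k; rewrite -mulnA mul2n doubleK -powR_mulrn ?powR_ge0//.
    rewrite powRAC -powRM ?powR_ge0// powR_mulrn//.
    by apply: ge0_ler_powR; rewrite ?nnegrE ?return_prob_ge0 ?(ltW gam0) ?mulr_ge0 ?exprn_ge0.
exists (C + 1); first by lra.
move=> m F F' f g uF uF' f0 g0 sg fa gb; rewrite energyE.
apply: le_trans (_ : d^-1 * C <= _).
  rewrite ler_wpM2l ?invr_ge0 ?step_count_ge0//.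
  apply: le_trans (hC m); apply: ler_sum => j _.
  by apply: (heat_pair _ a1 b1 _ uF uF' f0 g0 sg fa gb); exact: ltW.
apply: le_trans (_ : C <= _); last by lra.
by rewrite ler_piMl// invf_le1 ?step_count_gt0// step_count_ge1.
Qed.

(** The dual form of [energy_bound]. *)
Lemma potential_bound (N : nat) (a b : R) : heat_dimension N -> 1 < a -> 1 <= b ->
  2 < N%:R * (a^-1 + b^-1 - 1) ->
  exists2 C, 0 < C & forall m E F g, uniq E -> uniq F ->
    (forall x, 0 <= g x) -> supported_on F g ->
    psum b F g <= 1 -> psum (conj_exponent a) E (potential m g) <= C.
Proof.
move=> hN a1 b1 h; have [C C0 hC] := energy_bound hN (ltW a1) b1 h.
exists (C `^ conj_exponent a); first exact: powR_gt0.
move=> m E F g uE uF g0 sg gb; apply: psum_dual => //; first exact: ltW.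
  exact: potential_ge0.
by move=> f f0 _ fa; exact: (hC m E F).
Qed.

Lemma potential_bound_le N (a b K : R) : heat_dimension N -> 1 < a -> 1 <= b ->
  2 < N%:R * (a^-1 + b^-1 - 1) -> 0 < K ->
  exists2 C, 0 < C & forall m E F g, uniq E -> uniq F ->
    (forall x, 0 <= g x) -> supported_on F g ->
    psum b F g <= K -> psum (conj_exponent a) E (potential m g) <= C.
Proof.
move=> hN a1 b1 h K0; have [C C0 hC] := potential_bound hN a1 b1 h.
pose k := K `^ b^-1; have k0 : 0 < k by exact: powR_gt0.
exists (k `^ conj_exponent a * C); first by rewrite mulr_gt0// powR_gt0.
move=> m E F g uE uF g0 sg gK.
have -> : potential m g = (fun x => k * potential m (fun y => k^-1 * g y) x).
  by apply/funext => x; rewrite potentialZ mulVKf ?gt_eqF.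
have g0' x : 0 <= k^-1 * g x by rewrite mulr_ge0// invr_ge0 ltW.
rewrite psumZ; [|exact: ltW|exact: potential_ge0].
rewrite ler_wpM2l ?powR_ge0//; apply: (hC m E F) => //.
  by move=> x xF; rewrite sg ?mulr0.
have ki : 0 <= k^-1 by rewrite invr_ge0 ltW.
rewrite psumZ//.
have -> : k^-1 `^ b = K^-1.
  rewrite /k -powRN -powRrM mulNr mulVf; last by lra.
  by rewrite powR_inv1// ltW.
by rewrite mulrC ler_pdivrMr// mul1r.
Qed.

End Potential.

(** * Maximising the Green energy *)

(** The strict inequality leaves room for an exponent above [p]. The last
    condition, that the exponent [p1 (p - 1) / (p1 - 1)] of
    [energy_improvement] is still at least [1], holds near [p1 = p] because [p
    (2 - p) < 1]. *)
Lemma larger_exponent (R : realType) (N : nat) (p b : R) : 1 < p -> 1 < b ->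
  2 < N%:R * (p^-1 + b^-1 - 1) ->
  exists p1, [/\ p < p1, 2 < N%:R * (p1^-1 + b^-1 - 1) &
    1 <= p1 * (p - 1) / (p1 - 1)].
Proof.
move=> p1 b1 h.
have N0 : 0 < N%:R :> R.
  by rewrite ltr0n lt0n; apply/negP => /eqP N0; move: h; rewrite N0 mul0r; lra.
set y := p^-1; have yp : y * p = 1 by rewrite mulVf//; lra.
have y0 : 0 < y by rewrite invr_gt0; lra.
have b01 : b^-1 < 1 by rewrite invf_lt1//; lra.
have b00 : 0 < b^-1 by rewrite invr_gt0; lra.
have NV : 0 < 2 / N%:R :> R by rewrite divr_gt0.
pose w := Num.max (2 - p) (2 / N%:R + 1 - b^-1).
have w1 : 2 - p <= w by rewrite le_max lexx.
have w2 : 2 / N%:R + 1 - b^-1 <= w by rewrite le_max lexx orbT.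
have w3 : w < y.
  rewrite gt_max; apply/andP; split; first nra.
  have : 2 / N%:R < y + b^-1 - 1 by rewrite ltr_pdivrMr// mulrC.
  lra.
(* [w < 1 / p], and any reciprocal between them will do *)
pose z := (w + y) / 2.
have z0 : 0 < z by rewrite /z; lra.
have zy : z < y by rewrite /z; lra.
have wz : w < z by rewrite /z; lra.
have zz : z * z^-1 = 1 by rewrite mulfV// gt_eqF.
have q0 : 0 < z^-1 by rewrite invr_gt0.
have pz : p < z^-1 by rewrite -[p]invrK ltf_pV2// posrE.
exists z^-1; split; first exact: pz.
  rewrite invrK -ltr_pdivrMl// mulrC; lra.
rewrite ler_pdivlMr; last by lra.
by move: (z^-1) zz q0 pz => q zz q0 pz; nra.
Qed.

Section Maximizing.
Variables (R : realType) (G : groupType) (T : seq G).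
Hypothesis T1 : 1%g \in T.
Hypothesis TV : perm_eq [seq t^-1%g | t <- T] T.

Local Notation heat := (@heat R G T).
Local Notation d := (step_count R T).
Local Notation potential := (@potential R G T).
Local Notation energy := (@energy R G T).

Definition admissible (p b : R) F (f g : G -> R) :=
  [/\ uniq F, (forall x, 0 <= f x) /\ (forall x, 0 <= g x),
      supported_on F f /\ supported_on F g, psum p F f <= 1 & psum b F g <= 1].

Lemma admissibleC p b F f g : admissible p b F f g -> admissible b p F g f.
Proof. by case=> uF [f0 g0] [sf sg] fp gb; split. Qed.

Lemma energyC p b m F f g : admissible p b F f g -> energy m F g f = energy m F f g.
Proof. by case=> uF [f0 g0] [sf sg] fp gb; exact: energy_sym. Qed.

Lemma energyZ m F f g (k : R) : energy m F (fun x => k * f x) g = k * energy m F f g.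
Proof. by rewrite /energy mulr_sumr; apply: eq_bigr => x _; rewrite mulrA. Qed.

(** The dual function of the potential [v] of [g] is optimal against [g] on
    [F]. It is a bounded multiple of [v^(p'-1)], the bound coming from the
    lower bound [e] on the energy; and [v] lies in [l^(p1')], with [p1' < p'],
    by [potential_bound]. The exponent [p1 (p - 1) / (p1 - 1)] is [p1' / (p' -
    1)], and it is smaller than [p]. *)
Lemma energy_improvement (N : nat) (p b p1 e : R) :
  heat_dimension R T N -> 1 < p -> 1 < b ->
  p < p1 -> 2 < N%:R * (p1^-1 + b^-1 - 1) -> 0 < e ->
  exists2 C, 0 < C & forall m F f g, admissible p b F f g -> e <= energy m F f g ->
    exists f', [/\ admissible p b F f' g, energy m F f g <= energy m F f' g &
      psum (p1 * (p - 1) / (p1 - 1)) F f' <= C].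
Proof.
move=> hN p_gt1 b_gt1 pp1 h e0; set p0 := _ / _.
have p1_gt1 : 1 < p1 by lra.
have [C C0 hC] := potential_bound T1 TV hN p1_gt1 (ltW b_gt1) h.
set p' := conj_exponent p.
have p'_gt1 : 1 < p' := conj_exponent_gt1 p_gt1.
have p0_gt0 : 0 < p0 by rewrite divr_gt0 ?mulr_gt0//; lra.
exists ((e `^ p' `^ p^-1) ^-1 `^ p0 * C).
  by rewrite mulr_gt0// powR_gt0// invr_gt0 !powR_gt0.
move=> m F f g [uF [f0 g0] [sf sg] fp gb] ee.
pose v := potential m g.
have v0 x : 0 <= v x by exact: potential_ge0.
set A := psum p' F v.
have EA : energy m F f g <= A `^ p'^-1 by exact: psum_hoelder.
have eA : e `^ p' <= A.
  have p'0 : 0 <= p' by lra.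
  have := ge0_ler_powR p'0 (ltW e0 : _ \in Num.nneg) _ (le_trans ee EA).
  rewrite -powRrM mulVf ?gt_eqF//; last by lra.
  by rewrite powRr1 ?psum_ge0//; apply; exact: powR_ge0.
have A0 : 0 < A by apply: lt_le_trans eA; exact: powR_gt0.
have An0 : A != 0 by rewrite gt_eqF.
exists (dual_fun p F v); split.
- split => //; first by split => // x; exact: dual_fun_ge0.
    by split => // x; exact: dual_fun_out.
  by rewrite dual_fun_norm.
- by apply: le_trans EA _; rewrite -dual_fun_pair.
have p'p0 : (p' - 1) * p0 = conj_exponent p1.
  by rewrite /p0 conj_exponentB1// /conj_exponent; field; lra.
apply: le_trans (_ : ((A `^ p^-1)^-1) `^ p0 * psum (conj_exponent p1) F v <= _).
  rewrite /psum mulr_sumr !big_seq; apply: ler_sum => x xF.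
  by rewrite /dual_fun xF powRM ?invr_ge0 ?powR_ge0// -powRrM p'p0.
have ep : 0 <= p^-1 by rewrite invr_ge0; lra.
apply: ler_pM; [exact: powR_ge0|exact: psum_ge0| |exact: (hC m F F)].
apply: ge0_ler_powR; rewrite ?nnegrE ?invr_ge0; [exact: ltW|exact: powR_ge0|exact: powR_ge0|].
rewrite lef_pV2 ?posrE ?powR_gt0//.
by apply: ge0_ler_powR; rewrite ?nnegrE ?powR_ge0// ltW.
Qed.

(** If [f] is small everywhere, then [sum f^p1 <= (sup f)^(p1 - p) * sum f^p]
    is small as well, and the energy bound for [(p1, b)] makes the energy
    smaller than [e]. *)
Lemma near_maximizer_nonvanishing (N : nat) (p b p1 e : R) :
  heat_dimension R T N -> 1 < p -> 1 < b ->
  p < p1 -> 2 < N%:R * (p1^-1 + b^-1 - 1) -> 0 < e ->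
  exists2 c0, 0 < c0 & forall m F f g, admissible p b F f g -> e <= energy m F f g ->
    exists2 x, x \in F & c0 <= f x.
Proof.
move=> hN p_gt1 b_gt1 pp1 h e0.
have p1_gt1 : 1 < p1 by lra.
have [C C0 hC] := energy_bound T1 TV hN (ltW p1_gt1) (ltW b_gt1) h.
pose k := e / (2 * C).
have k0 : 0 < k by rewrite divr_gt0// mulr_gt0.
(* so that [c0 ^ (p1 - p) = k ^ p1], and [C * k] is only [e / 2] *)
pose c0 := k `^ (p1 / (p1 - p)).
exists c0; first exact: powR_gt0.
move=> m F f g [uF [f0 g0] [sf sg] fp gb] ee.
apply: contrapT => H.
have fc x : x \in F -> f x <= c0.
  by move=> xF; rewrite leNgt; apply/negP => /ltW c0f; apply: H; exists x.
have := hC m F F (fun x => k^-1 * f x) g uF uF _ g0 sg _ gb.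
rewrite energyZ mulrC ler_pdivrMr// => hh.
suff : e <= C * k.
  by have -> : C * k = e / 2 by [rewrite /k; field; lra]; lra.
apply: le_trans ee (hh _ _) => [x|].
  by rewrite mulr_ge0// invr_ge0 ltW.
rewrite psumZ// ?invr_ge0 ?(ltW k0)//.
have kp : 0 < k `^ p1 by rewrite powR_gt0.
rewrite -powR_inv1 ?(ltW k0)// -powRrM mulN1r powRN mulrC ler_pdivrMr// mul1r.
apply: le_trans (_ : k `^ p1 * psum p F f <= _); last by rewrite ler_piMr// ltW.
rewrite /psum mulr_sumr !big_seq; apply: ler_sum => x xF.
have -> : k `^ p1 = c0 `^ (p1 - p).
  by rewrite /c0 -powRrM mulfVK//; lra.
have {1}-> : p1 = (p1 - p) + p by rewrite subrK.
rewrite powRD; last by rewrite subrK; apply/implyP => /eqP; lra.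
rewrite ler_wpM2r ?powR_ge0//.
apply: ge0_ler_powR; rewrite ?nnegrE ?f0 ?powR_ge0 ?fc//; lra.
Qed.

Lemma psum_translate (a : R) F (f : G -> R) z :
  psum a [seq (z^-1 * y)%g | y <- F] (fun y => f (z * y)%g) = psum a F f.
Proof. by rewrite /psum big_map; apply: eq_bigr => y _; rewrite mulVKg. Qed.

Lemma supported_translate F (f : G -> R) z : supported_on F f ->
  supported_on [seq (z^-1 * y)%g | y <- F] (fun y => f (z * y)%g).
Proof.
move=> sf x xF; apply: sf; apply: contra xF => zxF.
by apply/mapP; exists (z * x)%g => //; rewrite mulKg.
Qed.

Lemma admissible_translate p b F f g z : admissible p b F f g ->
  admissible p b [seq (z^-1 * y)%g | y <- F] (fun y => f (z * y)%g) (fun y => g (z * y)%g).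
Proof.
case=> uF [f0 g0] [sf sg] fp gb; split; rewrite ?psum_translate//.
- by rewrite map_inj_uniq//; exact: mulgI.
- by split; exact: supported_translate.
Qed.

Lemma energy_translate m F f g z :
  energy m [seq (z^-1 * y)%g | y <- F] (fun y => f (z * y)%g) (fun y => g (z * y)%g)
  = energy m F f g.
Proof.
rewrite /energy big_map; apply: eq_bigr => y _.
by rewrite potential_translate mulVKg.
Qed.

Lemma energy_le m m' F f g : (m <= m')%N -> (forall x, 0 <= f x) ->
  (forall x, 0 <= g x) -> energy m F f g <= energy m' F f g.
Proof.
by move=> mm f0 g0; apply: ler_sum => x _; rewrite ler_wpM2l// potential_le.
Qed.

(** The sequence is improved in both variables and translated so that [f 1]
    stays away from [0]. The potential has nonnegative terms, so the cut-off
    [m] may be taken as large as desired. *)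
Lemma maximizing_sequence (N : nat) (p b : R) : heat_dimension R T N -> 1 < p -> 1 < b ->
  2 < N%:R * (p^-1 + b^-1 - 1) ->
  exists M C c0 p0 b0,
  [/\ [/\ 0 < M, 0 < C & 0 < c0], 1 <= p0 < p, 1 <= b0 < b,
   (forall m F f g, admissible p b F f g -> energy m F f g <= M) &
   forall n, exists m F f g, [/\ admissible p b F f g, (n <= m)%N,
      M - n.+1%:R^-1 <= energy m F f g, psum p0 F f <= C /\ psum b0 F g <= C &
      c0 <= f 1%g]].
Proof.
move=> hN p_gt1 b_gt1 h.
have h' : 2 < N%:R * (b^-1 + p^-1 - 1) by rewrite (addrC b^-1).
have [p1 [pp1 hp1 p0_ge1]] := larger_exponent p_gt1 b_gt1 h.
have [b1 [bb1 hb1 b0_ge1]] := larger_exponent b_gt1 p_gt1 h'.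
set p0 := _ / _ in p0_ge1; set b0 := _ / _ in b0_ge1.
have p0p : p0 < p by rewrite ltr_pdivrMr; nra.
have b0b : b0 < b by rewrite ltr_pdivrMr; nra.
pose E := [set e : R | exists m F f g, admissible p b F f g /\ e = energy m F f g].
pose dl : G -> R := dirac_at R 1%g.
have dl0 x : 0 <= dl x by rewrite ler0n.
have adl : admissible p b [:: 1%g] dl dl.
  have sdl : supported_on [:: 1%g] dl.
    by move=> x; rewrite inE /dl /dirac_at => /negbTE ->.
  have psdl a : psum a [:: 1%g] dl <= 1.
    by rewrite /psum big_seq1 /dl /dirac_at eqxx powR1.
  by split => //=.
have [C0 C00 hC0] := energy_bound T1 TV hN (ltW p_gt1) (ltW b_gt1) h.
have supE : has_sup E.
  split; first by exists (energy 1 [:: 1%g] dl dl), 1%N, [:: 1%g], dl, dl.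
  by exists C0 => _ [m [F [f [g [[uF [f0 g0] [sf sg] fp gb] ->]]]]]; exact: (hC0 m F F).
pose M := sup E.
have ubM m F f g : admissible p b F f g -> energy m F f g <= M.
  by move=> adm; apply: ub_le_sup; [exact: supE.2|exists m, F, f, g].
have M0 : 0 < M.
  apply: lt_le_trans (ubM 1%N _ _ _ adl).
  rewrite /energy big_seq1 {1}/dl /dirac_at eqxx mul1r mulr_gt0//.
    by rewrite invr_gt0 step_count_gt0.
  by rewrite big_ord_recl big_ord0 addr0 /= /dl /dirac_at eqxx.
have e0 : 0 < M / 2 by lra.
have [C1 C10 imp1] := energy_improvement hN p_gt1 b_gt1 pp1 hp1 e0.
have [C2 C20 imp2] := energy_improvement hN b_gt1 p_gt1 bb1 hb1 e0.
have [c0 c00 nonv] := near_maximizer_nonvanishing hN p_gt1 b_gt1 pp1 hp1 e0.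
exists M, (C1 + C2), c0, p0, b0.
rewrite M0 c00 addr_gt0// p0_ge1 p0p b0_ge1 b0b; split => // n.
(* the second term keeps the energy above [M / 2] for every [n] *)
pose eps := Num.min n.+1%:R^-1 (M / 2).
have eps0 : 0 < eps by rewrite lt_min e0 invr_gt0 ltr0n.
have [_ [m [F [f [g [adm ->]]]]] Em] := sup_adherent eps0 supE.
rewrite -/M in Em.
have {m}[m [nm {}Em]] : exists m, (n <= m)%N /\ M - eps < energy m F f g.
  exists (maxn n m); rewrite leq_maxl; split => //.
  apply: lt_le_trans Em _; case: adm => _ [f0 g0] _ _ _.
  by apply: energy_le => //; exact: leq_maxr.
have eM : M / 2 <= energy m F f g.
  have : eps <= M / 2 by rewrite ge_min lexx orbT.
  move: Em; lra.
have [f' [adm' ff' f'C]] := imp1 m F f g adm eM.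
have eM' : M / 2 <= energy m F g f' by rewrite (energyC _ adm') (le_trans eM).
have [g' [adm'' gg' g'C]] := imp2 m F g f' (admissibleC adm') eM'.
have adm3 := admissibleC adm''.
have Efg : energy m F f g <= energy m F f' g'.
  by rewrite -(energyC _ adm3) (le_trans ff')// -(energyC _ adm').
have [x xF c0x] := nonv m F f' g' adm3 (le_trans eM Efg).
exists m, [seq (x^-1 * y)%g | y <- F], (fun y => f' (x * y)%g), (fun y => g' (x * y)%g).
rewrite !psum_translate energy_translate mulg1; split => //.
- exact: admissible_translate.
- have : eps <= n.+1%:R^-1 by rewrite ge_min lexx.
  by move=> h1; apply: le_trans Efg; apply: le_trans (ltW Em); rewrite lerB.
- by split; [apply: le_trans f'C _|apply: le_trans g'C _]; lra.
Qed.

End Maximizing.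

(** * Pointwise limits along an ultrafilter *)

Section RealLimits.
Variable R : realType.

(** The values cluster in the compact interval, and an ultrafilter converges
    to each of its cluster points. One ultrafilter serves all points of the
    group at once, where subsequences would need a diagonal argument. *)
Lemma ultra_cvg (U : set_system nat) (a : nat -> R) (C : R) : UltraFilter U ->
  (forall n, 0 <= a n <= C) -> exists l : R, a n @[n --> U] --> l.
Proof.
move=> UU aC.
have PU : ProperFilter (a @ U) by exact: fmap_proper_filter.
have := @segment_compact R 0 C (a @ U) PU.
case.
  by apply: (@filterE _ U) => n /=; rewrite in_itv/=; exact: aC.
move=> l [_ cl]; exists l => B nB.
have [//|UB] := in_ultra_setVsetC (a @^-1` B) UU.
by have [x [/= xB]] := cl (~` B) B UB nB.
Qed.

Lemma cvg_sum_seq (U : set_system nat) (I : Type) (r : seq I) (a : I -> nat -> R)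
    (l : I -> R) : Filter U ->
  (forall i, a i n @[n --> U] --> l i) ->
  (\sum_(i <- r) a i n) @[n --> U] --> \sum_(i <- r) l i.
Proof.
move=> UF al; elim: r => [|i r IH].
  rewrite big_nil; under eq_fun do rewrite big_nil; exact: cvg_cst.
rewrite big_cons; under eq_fun do rewrite big_cons; exact: cvgD.
Qed.

Lemma cvg_powR (U : set_system nat) (a : nat -> R) (l r : R) : ProperFilter U ->
  0 < r -> (forall n, 0 <= a n) -> a n @[n --> U] --> l ->
  a n `^ r @[n --> U] --> l `^ r.
Proof.
move=> PU r0 a0 al.
have l0 : 0 <= l by apply: (cvgr_to_ge al); exact: nearW.
move: l0 al; rewrite le_eqVlt => /predU1P[<-|l0] al; last first.
  have rl : x `^ r @[x --> l] --> l `^ r.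
    apply: (@differentiable_continuous R R R l (fun x => x `^ r)).
    apply/derivable1_diffP; by apply: derivable_powR; rewrite in_itv/= l0.
  exact: cvg_comp al rl.
rewrite powR0 ?gt_eqF//; apply/cvgrPdist_lt => e e0.
have /cvgrPdist_lt/(_ (e `^ r^-1)) := al; rewrite powR_gt0// => /(_ isT).
apply: filterS => n; rewrite !sub0r !normrN !ger0_norm ?powR_ge0// => an.
rewrite (_ : e = e `^ r^-1 `^ r); last first.
  by rewrite -powRrM mulVf ?powRr1 ?gt_eqF// ltW.
by apply: gt0_ltr_powR; rewrite ?nnegrE ?powR_ge0.
Qed.

Lemma psum_limit (G : choiceType) (U : set_system nat) (h : nat -> G -> R) hl
    (a K : R) (E : seq G) :
  ProperFilter U -> 0 < a ->
  (forall n x, 0 <= h n x) -> (forall x, h n x @[n --> U] --> hl x) ->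
  (forall n, psum a E (h n) <= K) -> psum a E hl <= K.
Proof.
move=> PU a0 h0 hhl hK.
have hlE : psum a E (h n) @[n --> U] --> psum a E hl.
  by apply: cvg_sum_seq => x; exact: cvg_powR.
by apply: (cvgr_to_le hlE); exact: nearW.
Qed.

(** For a weight [th <= 1/2] the geometric mean [x^th y^(1-th)] equals [((x
    y)^(1/2))^(2 th) * y^(1 - 2 th)], so equality in the weighted inequality
    forces equality in [(x y)^(1/2) <= (x + y) / 2]. *)
Lemma amgm_eq_small_weight (th x y : R) : 0 < th -> th <= 2^-1 -> 0 <= x -> 0 <= y ->
  th * x + (1 - th) * y <= x `^ th * y `^ (1 - th) -> x = y.
Proof.
move=> th0 th2 x0 y0 h.
pose s := x `^ 2^-1; pose t := y `^ 2^-1.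
have ss : s ^+ 2 = x by rewrite -powR_mulrn ?powR_ge0// -powRrM mulVf// powRr1.
have tt : t ^+ 2 = y by rewrite -powR_mulrn ?powR_ge0// -powRrM mulVf// powRr1.
have s0 : 0 <= s by exact: powR_ge0.
have t0 : 0 <= t by exact: powR_ge0.
have E : x `^ th * y `^ (1 - th) = (s * t) `^ (2 * th) * y `^ (1 - 2 * th) * 1 `^ 0.
  rewrite powR1 mulr1 powRM// /s /t -!powRrM mulrA mulVf// mul1r -mulrA -powRD.
    by congr (_ * _ `^ _); lra.
  by apply/implyP => /eqP; lra.
have {}h : th * x + (1 - th) * y <= 2 * th * (s * t) + (1 - 2 * th) * y + 0 * 1.
  by apply: le_trans h _; rewrite E; apply: amgm3; rewrite ?mulr_ge0//; lra.
have : th * (s - t) ^+ 2 <= 0 by move: h; rewrite -ss -tt; nra.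
rewrite pmulr_rle0// => st2.
have : (s - t) ^+ 2 == 0 by rewrite eq_le st2 sqr_ge0.
by rewrite sqrf_eq0 subr_eq0 => /eqP; rewrite -ss -tt => ->.
Qed.

(** The equality case of Young's inequality, reduced to the equality case of
    the weighted arithmetic-geometric inequality for [f^p] and [w^p']. *)
Lemma young_eq (p f w : R) : 1 < p -> 0 <= f -> 0 <= w ->
  f `^ p / p + w `^ conj_exponent p / conj_exponent p <= f * w ->
  f = w `^ (conj_exponent p - 1).
Proof.
move=> p1 f0 w0; have p'1 := conj_exponent_gt1 p1.
have pE : conj_exponent p * p^-1 = conj_exponent p - 1.
  by rewrite /conj_exponent; field; lra.
have D := conj_exponentD p1; set p' := conj_exponent p in p'1 D pE *.
have ip0 : 0 < p^-1 by rewrite invr_gt0; lra.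
have ip'0 : 0 < p'^-1 by rewrite invr_gt0; lra.
have fE : f = (f `^ p) `^ p^-1 by rewrite -powRrM mulfV ?powRr1//; lra.
have wE : w = (w `^ p') `^ p'^-1 by rewrite -powRrM mulfV ?powRr1//; lra.
rewrite [X in _ <= X * _]fE [X in _ <= _ * X]wE => h.
have q1 : 1 - p^-1 = p'^-1 by rewrite -D (addrC p^-1) addrK.
have q2 : 1 - p'^-1 = p^-1 by rewrite -D addrK.
(* one of the two weights is at most [1/2]; it has to come first *)
have fw : f `^ p = w `^ p'.
  have [le2|gt2] := leP p^-1 2^-1.
    apply: (@amgm_eq_small_weight p^-1); rewrite ?powR_ge0//.
    by rewrite q1 mulrC (mulrC p'^-1).
  have le2 : p'^-1 <= 2^-1 by move: gt2; clear -D; lra.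
  have {}h : p'^-1 * w `^ p' + (1 - p'^-1) * f `^ p
      <= (w `^ p') `^ p'^-1 * (f `^ p) `^ (1 - p'^-1).
    by rewrite q2 [X in X <= _]addrC (mulrC p'^-1) (mulrC p^-1) [X in _ <= X]mulrC.
  by rewrite (amgm_eq_small_weight ip'0 le2 (powR_ge0 _ _) (powR_ge0 _ _) h).
by rewrite fE fw -powRrM pE.
Qed.

End RealLimits.

Section Limit.
Variables (R : realType) (G : groupType) (T : seq G).
Hypothesis T1 : 1%g \in T.
Hypothesis TV : perm_eq [seq t^-1%g | t <- T] T.

Local Notation heat := (@heat R G T).
Local Notation c := (return_prob R T).
Local Notation potential := (@potential R G T).
Local Notation energy := (@energy R G T).

(** [heat_pair] against a point mass. *)
Lemma heat_le_return n (a : R) F f x : 1 <= a -> uniq F -> supported_on F f ->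
  (forall x, 0 <= f x) -> psum a F f <= 1 -> heat n f x <= c n./2 `^ a^-1.
Proof.
move=> a1 uF sf f0 fa.
have := @heat_pair R G T T1 TV n [:: x] F (dirac_at R x) f 1 a (lexx _) a1.
rewrite invr1 [1 + _]addrC addrK => /(_ _ isT uF _ f0 sf _ fa).
rewrite /psum !big_seq1 /dirac_at eqxx powR1 mul1r lexx; apply => //.
by rewrite invr_ge0; lra.
Qed.

Lemma return_prob_cvg0 N : (0 < N)%N -> heat_dimension R T N ->
  c n./2 @[n --> \oo] --> 0.
Proof.
move=> N0 [L [H [L1 H0 cH]]]; apply/cvgrPdist_lt => e e0.
have /nonincreasing_seqP cmono := @return_prob_nincr R G T T1 TV.
pose k := Num.truncn (H / e).
have Hk : H < k.+1%:R * e by rewrite -ltr_pdivrMr// truncnS_gt.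
exists (L * 4 ^ k).*2 => // n /= nk.
rewrite sub0r normrN ger0_norm ?return_prob_ge0//.
apply: le_lt_trans (_ : c (L * 4 ^ k)%N < _).
  by apply: cmono; rewrite -[X in (X <= _)%N]doubleK half_leq.
apply: le_lt_trans (cH k) _.
have h2 : (2^-1 ^+ N) <= (2^-1 : R).
  by rewrite -[N]prednK// exprS ler_piMr ?invr_ge0// exprn_ile1 ?invr_ge0// invf_le1// ler1n.
apply: le_lt_trans (_ : H * 2^-1 ^+ k < _).
  by rewrite ler_wpM2l// lerXn2r ?nnegrE ?exprn_ge0 ?invr_ge0.
rewrite exprVn ltr_pdivrMr ?exprn_gt0//; apply: lt_le_trans Hk _.
rewrite mulrC ler_pM2l// -natrX ler_nat; exact: ltn_expl.
Qed.

(** The potential of [g] divided by [M] has norm at most [1] in [l^p'],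
    because [M] bounds every admissible energy. So the Young deficits, which
    are nonnegative, add up to at most [1/p + 1/p' - (M - e)/M = e/M], and
    each one of them is at most [e/M]. *)
Lemma young_deficit (p b M e : R) m F f g x : 1 < p -> 1 < b -> 0 < M ->
  (forall m F f g, admissible p b F f g -> energy m F f g <= M) ->
  admissible p b F f g -> M - e <= energy m F f g ->
  f x `^ p / p + (potential m g x / M) `^ conj_exponent p / conj_exponent p
    <= f x * (potential m g x / M) + e / M.
Proof.
move=> p1 b1 M0 ubM adm Em; have [uF [f0 g0] [sf sg] fp gb] := adm.
set p' := conj_exponent p; have p'1 : 1 < p' := conj_exponent_gt1 p1.
(* [x] may lie outside the support [F] *)
pose E := undup (x :: F).
have uE : uniq E := undup_uniq _.
have sub (h : G -> R) : supported_on F h -> supported_on E h.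
  move=> sh y; rewrite mem_undup inE negb_or => /andP[_]; exact: sh.
have xE : x \in E by rewrite mem_undup mem_head.
pose v := potential m g.
have v0 y : 0 <= v y by exact: potential_ge0.
pose w y := v y / M.
have w0 y : 0 <= w y by rewrite divr_ge0// ltW.
have fE : psum p E f <= 1.
  by apply: le_trans fp; apply: psum_supported => //; lra.
have Efv : \sum_(y <- E) f y * v y = energy m F f g.
  apply: supported_sum => // y; last by move=> /sf ->; rewrite mul0r.
  by move=> /(sub _ sf) ->; rewrite mul0r.
have wE : psum p' E w <= 1.
  have vE : psum p' E v <= M `^ p'.
    apply: psum_dual => // [|h h0 sh hp]; first exact: ltW.
    apply: (ubM m E h g); split => //; first by split => //; exact: sub.
    by apply: le_trans gb; apply: psum_supported => //; lra.
  have -> : w = (fun y => M^-1 * v y) by apply/funext => y; rewrite mulrC.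
  rewrite psumZ ?invr_ge0 ?(ltW M0)// -powR_inv1 ?(ltW M0)// -powRrM mulN1r powRN.
  by rewrite mulrC ler_pdivrMr ?powR_gt0// mul1r.
have Y y : 0 <= f y `^ p / p + w y `^ p' / p' - f y * w y.
  by rewrite subr_ge0 conjugate_powR ?conj_exponentD//; lra.
rewrite -lerBlDl.
apply: le_trans (_ : \sum_(y <- E) (f y `^ p / p + w y `^ p' / p' - f y * w y) <= _).
  rewrite (big_rem x)//= lerDl; apply: sumr_ge0 => y _; exact: Y.
rewrite sumrB big_split/= -!mulr_suml -!/(psum _ _ _).
have -> : \sum_(y <- E) f y * w y = energy m F f g / M.
  by rewrite -Efv mulr_suml; apply: eq_bigr => y _; rewrite mulrA.
have : 1 - e / M <= energy m F f g / M.
  by rewrite ler_pdivlMr// mulrBl mul1r mulfVK ?gt_eqF.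
have : psum p E f / p <= p^-1 by rewrite ler_piMl// invr_ge0; lra.
have : psum p' E w / p' <= p'^-1 by rewrite ler_piMl// invr_ge0; lra.
have := conj_exponentD p1; rewrite -/p'; lra.
Qed.

End Limit.

Section Profile.
Variables (R : realType) (G : groupType) (T : seq G).
Hypothesis T1 : 1%g \in T.
Hypothesis TV : perm_eq [seq t^-1%g | t <- T] T.

Local Notation heat := (@heat R G T).
Local Notation c := (return_prob R T).
Local Notation potential := (@potential R G T).
Local Notation energy := (@energy R G T).

(** Limits of finitely supported functions and of their truncated potentials,
    where the cut-off tends to infinity. The exponent [N p / (N - 2 p)] is
    critical for [p] but supercritical for [p0 < p], so [potential_bound_le]
    applies to it uniformly. *)
Lemma potential_limit (U : set_system nat) N (p p0 K : R) (m : nat -> nat)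
    (F : nat -> seq G) (h : nat -> G -> R) :
  UltraFilter U -> \oo `<=` U -> (0 < N)%N -> heat_dimension R T N ->
  1 <= p0 -> p0 < p -> 2 < N%:R * p^-1 -> 0 < K ->
  (forall n, (n <= m n)%N) -> (forall n, uniq (F n)) ->
  (forall n x, 0 <= h n x) -> (forall n, supported_on (F n) (h n)) ->
  (forall n, psum p (F n) (h n) <= 1) -> (forall n, psum p0 (F n) (h n) <= K) ->
  exists hl ul L,
  [/\ (forall x, h n x @[n --> U] --> hl x) /\
      (forall x, potential (m n) (h n) x @[n --> U] --> ul x),
      (forall x, 0 <= hl x) /\ (forall x, 0 <= ul x),
      (forall x, \sum_(t <- T) (ul x - ul (x * t)%g) = hl x),
      (forall E, uniq E -> psum p E hl <= 1) &
      (forall E, uniq E -> psum (N%:R * p / (N%:R - 2 * p)) E ul <= L)].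
Proof.
move=> UU Uoo N0 hN p0_ge1 p0p Np K0 nm uF h0 sh hp hp0.
have p1 : 1 < p by apply: le_lt_trans p0p.
have NR : 0 < N%:R :> R by rewrite ltr0n.
have N2p : 0 < N%:R - 2 * p.
  by move: Np; rewrite ltr_pdivlMr ?subr_gt0//; lra.
pose P := N%:R * p / (N%:R - 2 * p).
have P1 : 1 < P.
  rewrite /P ltr_pdivlMr// mul1r; apply: lt_trans (_ : N%:R * 1 < _).
    by lra.
  by rewrite ltr_pM2l.
pose a := conj_exponent P.
have a1 : 1 < a := conj_exponent_gt1 P1.
(* with [P] critical for [p], the excess over [2] is [N (1 / p0 - 1 / p)] *)
have range : 2 < N%:R * (a^-1 + p0^-1 - 1).
  rewrite conj_exponentV//.
  have -> : P^-1 = p^-1 - 2 / N%:R.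
    by rewrite /P; field; rewrite !gt_eqF//; lra.
  have -> : N%:R * (1 - (p^-1 - 2 / N%:R) + p0^-1 - 1) = 2 + N%:R * (p0^-1 - p^-1).
    by field; rewrite !gt_eqF//; lra.
  rewrite ltrDl mulr_gt0// subr_gt0 ltf_pV2// posrE; lra.
have [L L0 hL] := potential_bound_le T1 TV hN a1 p0_ge1 range K0.
rewrite conj_exponentK// in hL.
pose u n := potential (m n) (h n).
have u0 n x : 0 <= u n x by exact: potential_ge0.
have uL n E : uniq E -> psum P E (u n) <= L by move=> uE; exact: (hL (m n) E (F n)).
have hE n E : uniq E -> psum p E (h n) <= 1.
  move=> uE; apply: le_trans (hp n); apply: psum_supported => //.
  by lra.
have p_gt0 : 0 < p by lra.
have P_gt0 : 0 < P by lra.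
have PU : ProperFilter U by exact: ultra_proper.
have [hl hhl] : {hl : G -> R & forall x, h n x @[n --> U] --> hl x}.
  apply: (@choice _ _ (fun x l => h n x @[n --> U] --> l)) => x.
  apply: (ultra_cvg UU (C := 1 `^ p^-1)) => n; rewrite h0/=.
  by apply: (psum_pointwise (a := p) (F := [:: x])); rewrite ?mem_head// hE.
have [ul uul] : {ul : G -> R & forall x, u n x @[n --> U] --> ul x}.
  apply: (@choice _ _ (fun x l => u n x @[n --> U] --> l)) => x.
  apply: (ultra_cvg UU (C := L `^ P^-1)) => n; rewrite u0/=.
  by apply: (psum_pointwise (a := P) (F := [:: x])); rewrite ?mem_head// uL.
exists hl, ul, L; split => //.
- split => x; [apply: (cvgr_to_ge (hhl x))|apply: (cvgr_to_ge (uul x))]; exact: nearW.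
- move=> x.
  have cvg0 : heat (m n) (h n) x @[n --> U] --> 0.
    have c0 : c n./2 `^ p^-1 @[n --> U] --> 0.
      have -> : 0 = 0 `^ p^-1 :> R by rewrite powR0// invr_eq0 gt_eqF.
      apply: cvg_powR => //; first by rewrite invr_gt0.
        by move=> n; exact: return_prob_ge0.
      by apply: cvg_trans (return_prob_cvg0 T1 TV N0 hN); exact: cvg_app.
    apply: (squeeze_cvgr _ (cvg_cst 0) c0); apply: nearW => n.
    rewrite heat_ge0//=.
    apply: le_trans (heat_le_return T1 TV (m n) x (ltW p1) (uF n) (sh n) (h0 n) (hp n)) _.
    apply: ge0_ler_powR; rewrite ?nnegrE ?return_prob_ge0//; first by rewrite invr_ge0 ltW.
    have /nonincreasing_seqP cmono := @return_prob_nincr R G T T1 TV.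
    by apply: cmono; exact: half_leq.
  have lim1 : \sum_(t <- T) (u n x - u n (x * t)%g) @[n --> U]
      --> \sum_(t <- T) (ul x - ul (x * t)%g).
    by apply: cvg_sum_seq => t; exact: cvgB.
  have lim2 : \sum_(t <- T) (u n x - u n (x * t)%g) @[n --> U] --> hl x - 0.
    under eq_fun do rewrite potential_laplacian//.
    exact: cvgB.
  by rewrite (cvg_unique _ lim1 lim2) ?subr0.
- by move=> E uE; apply: psum_limit hhl _ => // n; exact: hE.
- by move=> E uE; apply: psum_limit uul _ => // n; exact: uL.
Qed.

Lemma profile_equation (U : set_system nat) (p fl wl : R) (f w : nat -> R)
    (e : nat -> R) :
  ProperFilter U -> 1 < p -> (forall n, 0 <= f n) -> (forall n, 0 <= w n) ->
  f n @[n --> U] --> fl -> w n @[n --> U] --> wl -> e n @[n --> U] --> 0 ->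
  (forall n, f n `^ p / p + w n `^ conj_exponent p / conj_exponent p <= f n * w n + e n) ->
  fl = wl `^ (conj_exponent p - 1).
Proof.
move=> PU p1 f0 w0 ffl wwl e0 fw.
have p'1 := conj_exponent_gt1 p1.
have fl0 : 0 <= fl by apply: (cvgr_to_ge ffl); exact: nearW.
have wl0 : 0 <= wl by apply: (cvgr_to_ge wwl); exact: nearW.
apply: young_eq => //.
set p' := conj_exponent p in p'1 fw *.
have p0 : 0 < p by lra.
have p'0 : 0 < p' by lra.
have L1 : f n `^ p / p + w n `^ p' / p' @[n --> U] --> fl `^ p / p + wl `^ p' / p'.
  by apply: cvgD; (apply: cvgM; [exact: cvg_powR|exact: cvg_cst]).
have L2 : f n * w n + e n @[n --> U] --> fl * wl + 0 by apply: cvgD => //; exact: cvgM.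
rewrite -[X in _ <= X]addr0 -subr_ge0.
apply: (cvgr_to_ge (cvgB L2 L1)); apply: nearW => n.
by rewrite subr_ge0.
Qed.

(** The deficits of [young_deficit] tend to [0] at every point, in both
    variables because the energy is symmetric, and the lower bound on [f 1]
    survives the limit. *)
Lemma profile_exists N (p b : R) : (0 < N)%N -> heat_dimension R T N ->
  1 < p -> 1 < b -> 2 < N%:R * (p^-1 + b^-1 - 1) ->
  exists M L (f g u v : G -> R),
  [/\ 0 < M /\ 0 < f 1%g,
      [/\ forall x, 0 <= f x, forall x, 0 <= g x, forall x, 0 <= u x & forall x, 0 <= v x],
      forall x, \sum_(t <- T) (u x - u (x * t)%g) = f x /\
                \sum_(t <- T) (v x - v (x * t)%g) = g x,
      forall x, f x = (v x / M) `^ (conj_exponent p - 1) /\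
                g x = (u x / M) `^ (conj_exponent b - 1) &
      forall E, uniq E -> [/\ psum p E f <= 1, psum b E g <= 1,
        psum (N%:R * p / (N%:R - 2 * p)) E u <= L &
        psum (N%:R * b / (N%:R - 2 * b)) E v <= L]].
Proof.
move=> N0 hN p1 b1 h.
have [M [C [c0 [p0 [b0 [[M0 C0 c00] /andP[p01 p0p] /andP[b01 b0b] ubM maxseq]]]]]] :=
  maximizing_sequence T1 TV hN p1 b1 h.
have [z zP] : {z : nat -> nat * (seq G * ((G -> R) * (G -> R))) & forall n,
    [/\ admissible p b (z n).2.1 (z n).2.2.1 (z n).2.2.2, (n <= (z n).1)%N,
      M - n.+1%:R^-1 <= energy (z n).1 (z n).2.1 (z n).2.2.1 (z n).2.2.2,
      psum p0 (z n).2.1 (z n).2.2.1 <= C /\ psum b0 (z n).2.1 (z n).2.2.2 <= C &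
      c0 <= (z n).2.2.1 1%g]}.
  apply: (@choice _ _ (fun n z => [/\ admissible p b z.2.1 z.2.2.1 z.2.2.2, (n <= z.1)%N,
      M - n.+1%:R^-1 <= energy z.1 z.2.1 z.2.2.1 z.2.2.2,
      psum p0 z.2.1 z.2.2.1 <= C /\ psum b0 z.2.1 z.2.2.2 <= C & c0 <= z.2.2.1 1%g])) => n.
  by have [m [F [f [g H]]]] := maxseq n; exists (m, (F, (f, g))).
pose m n := (z n).1; pose F n := (z n).2.1.
pose f n := (z n).2.2.1; pose g n := (z n).2.2.2.
have adm n : admissible p b (F n) (f n) (g n) by case: (zP n).
have nm n : (n <= m n)%N by case: (zP n).
have Em n : M - n.+1%:R^-1 <= energy (m n) (F n) (f n) (g n) by case: (zP n).
have fC n : psum p0 (F n) (f n) <= C by case: (zP n) => _ _ _ [].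
have gC n : psum b0 (F n) (g n) <= C by case: (zP n) => _ _ _ [].
have fc0 n : c0 <= f n 1%g by case: (zP n).
move: (m) (F) (f) (g) adm nm Em fC gC fc0 => {zP z m F f g} m F f g adm nm Em fC gC fc0.
have uF n : uniq (F n) by case: (adm n).
have f0 n x : 0 <= f n x by case: (adm n) => _ [].
have g0 n x : 0 <= g n x by case: (adm n) => _ [].
have sf n : supported_on (F n) (f n) by case: (adm n) => _ _ [].
have sg n : supported_on (F n) (g n) by case: (adm n) => _ _ [].
have fp n : psum p (F n) (f n) <= 1 by case: (adm n).
have gb n : psum b (F n) (g n) <= 1 by case: (adm n).
have [U [UU Uoo]] := ultraFilterLemma eventually_filter.
have NR : 0 < N%:R :> R by rewrite ltr0n.
have rec (a : R) : 1 < a -> N%:R * (a^-1 - 1) < 0.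
  by move=> a1; rewrite pmulr_rlt0// subr_lt0 invf_lt1 ?a1//; lra.
have Np : 2 < N%:R * p^-1 by move: (rec b b1) h; lra.
have Nb : 2 < N%:R * b^-1 by move: (rec p p1) h; lra.
have [fl [ul [L1 [[ffl uul] [fl0 ul0] ulap flp ulL]]]] :=
  potential_limit UU Uoo N0 hN p01 p0p Np C0 nm uF f0 sf fp fC.
have [gl [vl [L2 [[ggl vvl] [gl0 vl0] vlap glb vlL]]]] :=
  potential_limit UU Uoo N0 hN b01 b0b Nb C0 nm uF g0 sg gb gC.
have PU : ProperFilter U by exact: ultra_proper.
have ecvg : (n.+1%:R^-1 / M : R) @[n --> U] --> 0.
  rewrite -(mul0r M^-1); apply: cvgM; last exact: cvg_cst.
  by apply: cvg_trans (@cvg_harmonic R); exact: cvg_app.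
have ub' k E h1 h2 : admissible b p E h1 h2 -> energy k E h1 h2 <= M.
  by move=> /admissibleC a; rewrite (energyC TV k a); exact: ubM.
have vM x : potential (m n) (g n) x / M @[n --> U] --> vl x / M.
  by apply: cvgM (vvl x) _; exact: cvg_cst.
have uM x : potential (m n) (f n) x / M @[n --> U] --> ul x / M.
  by apply: cvgM (uul x) _; exact: cvg_cst.
exists M, (Num.max L1 L2), fl, gl, ul, vl; split => //.
- by split => //; apply: lt_le_trans c00 _; apply: (cvgr_to_ge (ffl _)); exact: nearW.
- move=> x; split.
    apply: (profile_equation PU p1 (f0 ^~ x) _ (ffl x) (vM x) ecvg) => n /=.
      by rewrite divr_ge0 ?(ltW M0)// potential_ge0.
    by apply: (young_deficit T1 x p1 b1 M0 ubM (adm n)); exact: Em.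
  apply: (profile_equation PU b1 (g0 ^~ x) _ (ggl x) (uM x) ecvg) => n /=.
    by rewrite divr_ge0 ?(ltW M0)// potential_ge0.
  apply: (young_deficit T1 x b1 p1 M0 ub' (admissibleC (adm n))).
  by rewrite (energyC TV _ (adm n)).
- move=> E uE; split; [exact: flp|exact: glb| |].
    by apply: le_trans (ulL E uE) _; rewrite le_max lexx.
  by apply: le_trans (vlL E uE) _; rewrite le_max lexx orbT.
Qed.

End Profile.

(** * Cayley graphs of polynomial growth *)

Section Cayley.
Variables (R : realType) (G : groupType) (S : set G).
Hypothesis hS : finite_symmetric_generating S.

Definition lazy_steps : seq G := 1%g :: enum_fset (fset_set S).
Local Notation T := lazy_steps.

Lemma mem_generators s : (s \in enum_fset (fset_set S)) = (s \in S).
Proof. by case: hS => fS _ _; rewrite in_fset_set. Qed.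

Lemma lazy_steps1 : 1%g \in T.
Proof. exact: mem_head. Qed.

Lemma lazy_stepsV : perm_eq [seq t^-1%g | t <- T] T.
Proof.
rewrite /lazy_steps /= invg1 perm_cons; apply: uniq_perm.
- by rewrite map_inj_uniq ?fset_uniq//; exact: invg_inj.
- exact: fset_uniq.
have [_ SV _] := hS.
have inV s : s \in S -> (s^-1)%g \in S.
  by rewrite !inE => Ss; rewrite SV; exists s.
move=> x; rewrite mem_generators; apply/mapP/idP => [[s]|xS].
  by rewrite mem_generators => /inV + ->.
by exists x^-1%g; rewrite ?invgK// mem_generators inV.
Qed.

Lemma is_word_lazy w : is_word S w -> {subset w <= T}.
Proof. by move=> wS s /wS Ss; rewrite inE mem_generators mem_set ?orbT. Qed.

Lemma lazy_laplacian (u : G -> R) x :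
  - laplacian S u x = \sum_(t <- T) (u x - u (x * t)%g).
Proof.
have -> : laplacian S u x = \sum_(y <- [seq (x * s)%g | s <- enum_fset (fset_set S)]) (u y - u x).
  have uS : uniq [seq (x * s)%g | s <- enum_fset (fset_set S)].
    by rewrite map_inj_uniq ?fset_uniq//; exact: mulgI.
  rewrite /laplacian [RHS]fsbig_seq//.
  suff -> : [set y | Defs.adjacent S y x] = [set` [seq (x * s)%g | s <- enum_fset (fset_set S)]].
    by [].
  apply/seteqP; split => y /=.
    move=> [s Ss ->]; apply/mapP; exists s => //.
    by rewrite mem_generators mem_set.
  by move=> /mapP[s]; rewrite mem_generators inE => Ss ->; exists s.
rewrite big_map /lazy_steps big_cons mulg1 subrr add0r -sumrN.
by apply: eq_bigr => s _; rewrite opprB.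
Qed.

(** The lower bound on the growth function is what [return_prob_ball] needs to
    become the hypothesis of [nash_decay]. *)
Lemma growth_heat_dimension N : polynomial_growth S R N ->
  heat_dimension R T N.
Proof.
move=> [C1 [C2 [C10 C20 hC]]].
have T1 := lazy_steps1; have TV := lazy_stepsV.
apply: (@nash_decay R (return_prob R T) N C1^-1 (step_count R T ^+ 2)).
- exact: return_prob_nincr.
- by rewrite return_prob0.
- by rewrite invr_ge0 ltW.
- by rewrite exprn_ege1// step_count_ge1.
move=> n r r1; have /andP[lo _] := hC r r1.
have rN : 0 < r%:R ^+ N :> R by rewrite exprn_gt0// ltr0n.
have b0 : 0 < (growth S r)%:R :> R by apply: lt_le_trans lo; rewrite mulr_gt0.
have := @return_prob_ball R G T T1 TV n r (enum_fset (fset_set (word_ball S r))) (fset_uniq _) _.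
have words g : g \in enum_fset (fset_set (word_ball S r)) -> exists w : seq G,
    [/\ {subset w <= T}, (size w <= r)%N & g = (\prod_(s <- w) s)%g].
  have [fin|nfin] := pselect (finite_set (word_ball S r)); last first.
    by move: b0; rewrite /growth /fset_set; case: pselect => // _; rewrite cardfs0 ltxx.
  rewrite in_fset_set// inE => -[k [[w [wS wk ->]] _] kr].
  by exists w; rewrite mul1g wk; split => //; exact: is_word_lazy.
move=> /(_ words); rewrite -/(growth S r); set X := _ * (_ * _).
rewrite -ler_pdivlMl// mulrDr mulr1 mulKf ?gt_eqF// => /le_trans; apply.
rewrite lerD2r -invfM lef_pV2 ?posrE ?mulr_gt0//.
Qed.

(** At a zero of [w] the sum of [- w (x * t)] is nonnegative, so [w] vanishes
    at all neighbours, hence everywhere because the steps generate the group;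
    this contradicts [0 < h x1]. *)
Lemma superharmonic_pos (w h : G -> R) x1 : (forall x, 0 <= w x) ->
  (forall x, 0 <= h x) -> (forall x, \sum_(t <- T) (w x - w (x * t)%g) = h x) ->
  0 < h x1 -> forall x, 0 < w x.
Proof.
move=> w0 h0 wh hx1 x; rewrite lt_neqAle w0 andbT; apply/negP => /eqP wx.
have nbr y t : w y = 0 -> t \in T -> w (y * t)%g = 0.
  move=> wy tT; apply/eqP; rewrite eq_le w0 andbT -oppr_ge0.
  apply: le_trans (h0 y) _; rewrite -wh (big_rem t)//= wy sub0r gerDl.
  by apply: sumr_le0 => s _; rewrite sub0r oppr_le0.
have word (v : seq G) y : {subset v <= T} -> w y = 0 -> w (y * \prod_(s <- v) s)%g = 0.
  elim: v y => [|s v IH] y vT wy; first by rewrite big_nil mulg1.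
  rewrite big_cons mulgA; apply: IH; last by apply: nbr => //; apply: vT; exact: mem_head.
  by move=> t tv; apply: vT; rewrite inE tv orbT.
have all0 y : w y = 0.
  have [_ _ /(_ (x^-1 * y)%g)[v vS vE]] := hS.
  rewrite -[y](mulVKg x) vE; apply: word => //; exact: is_word_lazy.
move: hx1; rewrite -wh big1 ?ltxx// => t _; by rewrite !all0 subrr.
Qed.

Lemma lnorm_lty (r L : R) (u : G -> R) :
  (forall E, uniq E -> psum r E (fun x => `|u x|) <= L) -> (lnorm r u < +oo)%E.
Proof.
move=> uL; apply: poweR_lty.
apply: (@le_lt_trans _ _ L%:E); last exact: ltry.
apply: ge_ereal_sup => _ [A [fA _] <-].
rewrite fsbig_finite// sumEFin lee_fin.
exact: uL (enum_fset (fset_set A)) (fset_uniq _).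
Qed.

(** Both unknowns are powers of [M]; the exponents solve a linear system whose
    determinant is [1 - r s]. *)
Lemma scaling_pair (M r s : R) : 0 < M -> r * s != 1 ->
  exists k l, [/\ 0 < k, 0 < l, k = (M * l) `^ r & l = (M * k) `^ s].
Proof.
move=> M0 rs; pose e := (s + 1) * r / (1 - r * s).
have den : 1 - r * s != 0 by rewrite subr_eq0 eq_sym.
have pM a : (M * M `^ a) = M `^ (1 + a).
  rewrite -{1}[M]powRr1 ?(ltW M0)// -powRD //.
  by rewrite (gt_eqF M0) implybT.
exists (M `^ e), (M `^ ((1 + e) * s)); rewrite !powR_gt0//; split => //.
  rewrite pM -powRrM; congr (_ `^ _); rewrite /e; field.
  by [].
by rewrite pM -powRrM.
Qed.

End Cayley.

Theorem corollary3 (R : realType) (G : groupType) (S : set G)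
    (hS : finite_symmetric_generating S)
    (N : nat) (hgrowth : polynomial_growth S R N) (hN : (3 <= N)%N)
    (p q : R) (hp : 1 < p) (hq : 1 < q)
    (hpq : 1 / conj_exponent p + 1 / q < (N%:R - 2) / N%:R) :
  exists u v : G -> R,
    [/\ forall x, - laplacian S u x
                  = `|v x| `^ (conj_exponent p - 2) * v x,
        forall x, - laplacian S v x = `|u x| `^ (q - 2) * u x,
        in_D2 S N p u,
        in_D2 S N (conj_exponent q) v
      & forall x, 0 < u x /\ 0 < v x].
Proof.
have hdim := growth_heat_dimension hS hgrowth.
have N0 : (0 < N)%N by exact: leq_trans hN.
have NR : 0 < N%:R :> R by rewrite ltr0n.
set p' := conj_exponent p in hpq *; set b := conj_exponent q.
have p'1 : 1 < p' := conj_exponent_gt1 hp.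
have b1 : 1 < b := conj_exponent_gt1 hq.
have hpq' : p'^-1 + q^-1 < 1 - 2 / N%:R.
  by move: hpq; rewrite !div1r mulrBl mulfV// gt_eqF.
have range : 2 < N%:R * (p^-1 + b^-1 - 1).
  rewrite -ltr_pdivrMl// mulrC conj_exponentV//.
  by move: hpq'; rewrite /p' conj_exponentV//; lra.
have [M [L [f [g [u [v [[M0 f10] [f0 g0 u0 v0] lap prof bnd]]]]]]] :=
  profile_exists (lazy_steps1 S) (lazy_stepsV hS) N0 hdim hp b1 range.
rewrite -/p' (conj_exponentK hq) in prof.
have ulap x : - laplacian S u x = f x by rewrite lazy_laplacian//; case: (lap x).
have vlap x : - laplacian S v x = g x by rewrite lazy_laplacian//; case: (lap x).
have upos : forall x, 0 < u x.
  by apply: (superharmonic_pos hS u0 f0 _ f10) => x; case: (lap x).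
have gpos x : 0 < g x.
  by case: (prof x) => _ ->; rewrite powR_gt0// divr_gt0.
have vpos : forall x, 0 < v x.
  by apply: (superharmonic_pos hS v0 g0 _ (gpos 1%g)) => x; case: (lap x).
have laplacianZ k w x : - laplacian S (fun y => k * w y) x = k * - laplacian S w x.
  rewrite !lazy_laplacian// mulr_sumr; apply: eq_bigr => t _.
  by rewrite mulrBr.
(* [1 / p' + 1 / q < 1] means [(p' - 1) (q - 1) > 1] *)
have rs : (p' - 1) * (q - 1) != 1.
  have NV : 0 < 2 / N%:R :> R by rewrite divr_gt0.
  rewrite gt_eqF//.
  have : q * p' * (p'^-1 + q^-1) < q * p' * 1.
    rewrite ltr_pM2l; last by rewrite mulr_gt0//; lra.
    lra.
  have -> : q * p' * (p'^-1 + q^-1) = q + p'.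
    by field; rewrite !gt_eqF//; lra.
  lra.
have [k [l [k0 l0 kE lE]]] := scaling_pair M0 rs.
have fsc x : k * f x = (l * v x) `^ (p' - 1).
  case: (prof x) => -> _; rewrite {1}kE -powRM; last first.
  - by rewrite divr_ge0// ltW.
  - by rewrite mulr_ge0// ltW.
  by congr (_ `^ _); field; rewrite gt_eqF.
have gsc x : l * g x = (k * u x) `^ (q - 1).
  case: (prof x) => _ ->; rewrite {1}lE -powRM; last first.
  - by rewrite divr_ge0// ltW.
  - by rewrite mulr_ge0// ltW.
  by congr (_ `^ _); field; rewrite gt_eqF.
have pow (x e : R) : 0 < x -> 1 < e -> x `^ (e - 1) = `|x| `^ (e - 2) * x.
  move=> x0 e1; rewrite gtr0_norm// mulrC -(@mulr_powRB1 _ x (e - 1)) ?(ltW x0)//.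
    by congr (_ * _ `^ _); lra.
  by rewrite subr_gt0.
have inD2 (a c : R) (h w : G -> R) : 0 < c -> (forall x, 0 <= h x) ->
    (forall x, 0 <= w x) -> (forall x, - laplacian S w x = h x) ->
    (forall E, uniq E -> psum a E h <= 1 /\ psum (N%:R * a / (N%:R - 2 * a)) E w <= L) ->
    in_D2 S N a (fun x => c * w x).
  move=> c0 h0 w0 wlap bd; split.
    apply: (@lnorm_lty _ _ _ (c `^ (N%:R * a / (N%:R - 2 * a)) * L)) => E uE.
    have -> : (fun x => `|c * w x|) = (fun x => c * w x).
      by apply/funext => x; rewrite ger0_norm// mulr_ge0// ltW.
    by rewrite psumZ ?(ltW c0)// ler_wpM2l ?powR_ge0//; case: (bd E uE).
  apply: (@lnorm_lty _ _ _ (c `^ a * 1)) => E uE.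
  have -> : (fun x => `|laplacian S (fun y => c * w y) x|) = (fun x => c * h x).
    by apply/funext => x; rewrite -normrN laplacianZ wlap ger0_norm// mulr_ge0// ltW.
  by rewrite psumZ ?(ltW c0)// ler_wpM2l ?powR_ge0//; case: (bd E uE).
exists (fun x => k * u x), (fun x => l * v x); split.
- by move=> x; rewrite laplacianZ ulap fsc pow// mulr_gt0.
- by move=> x; rewrite laplacianZ vlap gsc pow// mulr_gt0.
- by apply: (inD2 _ _ f) => // E uE; case: (bnd E uE).
- by apply: (inD2 _ _ g) => // E uE; case: (bnd E uE).
- by move=> x; rewrite !mulr_gt0.
Qed.
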